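(* Let $G=A*B$ be a free product of groups $A$ and $B$, and let $g=a_1b_1a_2b_2\cdots a_Lb_L$ with $L\ge1$, $a_i\in A\setminus\{1\}$, $b_i\in B\setminus\{1\}$, and suppose $g\in[G,G]$. Let $N\in\{2,3,\dots\}\cup\{\infty\}$ be the minimum of the orders of the elements $a_1,\dots,a_L,b_1,\dots,b_L$ (with $N=\infty$ if all have infinite order, and the convention $1/\infty=0$). Then $$\mathrm{scl}_G(g)\ \ge\ \frac12-\frac1N.$$
   Context: For a group $G$, $[G,G]$ is its commutator subgroup. For $h\in[G,G]$, the commutator length $\mathrm{cl}_G(h)$ is the least $n\ge 0$ such that $h=[a_1,b_1]\cdots[a_n,b_n]$ for some $a_i,b_i\in G$. The stable commutator length is $\mathrm{scl}_G(g)=\lim_{n\to\infty}\mathrm{cl}_G(g^n)/n$ for $g\in[G,G]$. *)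

(* Defs.v *)
From Stdlib Require Import Reals List Arith ClassicalEpsilon.
Open Scope R_scope.

Record Group : Type := MkGroup {
  carrier :> Type;
  gmul : carrier -> carrier -> carrier;
  gone : carrier;
  ginv : carrier -> carrier;
  gmul_assoc : forall x y z, gmul x (gmul y z) = gmul (gmul x y) z;
  gmul_1l : forall x, gmul gone x = x;
  gmul_1r : forall x, gmul x gone = x;
  gmul_Vl : forall x, gmul (ginv x) x = gone;
  gmul_Vr : forall x, gmul x (ginv x) = gone
}.
Arguments gmul {g} _ _.
Arguments gone {g}.
Arguments ginv {g} _.

Definition is_hom (G H : Group) (f : G -> H) : Prop :=
  forall x y : G, f (gmul x y) = gmul (f x) (f y).

Fixpoint gpow {G : Group} (x : G) (n : nat) : G :=
  match n with O => gone | S k => gmul x (gpow x k) end.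

Definition comm {G : Group} (a b : G) : G :=
  gmul (gmul a b) (gmul (ginv a) (ginv b)).

Definition IsFreeProduct (A B G : Group) (iA : A -> G) (iB : B -> G) : Prop :=
  is_hom A G iA /\ is_hom B G iB /\
  forall (H : Group) (fA : A -> H) (fB : B -> H),
    is_hom A H fA -> is_hom B H fB ->
    (exists phi : G -> H, is_hom G H phi /\
        (forall x, phi (iA x) = fA x) /\ (forall y, phi (iB y) = fB y)) /\
    (forall phi psi : G -> H, is_hom G H phi -> is_hom G H psi ->
        (forall x, phi (iA x) = fA x) -> (forall y, phi (iB y) = fB y) ->
        (forall x, psi (iA x) = fA x) -> (forall y, psi (iB y) = fB y) ->
        forall z, phi z = psi z).

Fixpoint gprod {G : Group} (l : list G) : G :=
  match l with nil => gone | x :: t => gmul x (gprod t) end.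

Definition in_commutator_subgroup (G : Group) (h : G) : Prop :=
  exists l : list G,
    Forall (fun x => exists a b : G, x = comm a b \/ x = ginv (comm a b)) l
    /\ gprod l = h.

Definition is_prod_comms (G : Group) (h : G) (n : nat) : Prop :=
  exists a b : nat -> G, gprod (map (fun i => comm (a i) (b i)) (seq 0 n)) = h.

Definition is_cl (G : Group) (h : G) (n : nat) : Prop :=
  is_prod_comms G h n /\ forall m, is_prod_comms G h m -> (n <= m)%nat.

(* commutator length (meaningful for h in [G,G]) *)
Definition cl (G : Group) (h : G) : nat :=
  epsilon (inhabits 0%nat) (fun n => is_cl G h n).

(* scl_G(g) is the limit of cl(g^n)/n; we index by n+1 to avoid n = 0 *)
Definition cl_ratio (G : Group) (g : G) (n : nat) : R :=
  INR (cl G (gpow g (S n))) / INR (S n).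

Definition has_order {G : Group} (x : G) (k : nat) : Prop :=
  (0 < k)%nat /\ gpow x k = gone /\
  forall j, (0 < j < k)%nat -> gpow x j <> gone.

Definition infinite_order {G : Group} (x : G) : Prop :=
  forall k, (0 < k)%nat -> gpow x k <> gone.

Definition min_order {G : Group} (x : nat -> G) (L : nat) (N : option nat) : Prop :=
  match N with
  | None => forall i, (i < L)%nat -> infinite_order (x i)
  | Some n => (exists i, (i < L)%nat /\ has_order (x i) n) /\
              forall i k, (i < L)%nat -> has_order (x i) k -> (n <= k)%nat
  end.

Definition min_order2 {A B : Group} (a : nat -> A) (b : nat -> B) (L : nat)
  (N : option nat) : Prop :=
  match N with
  | None => (forall i, (i < L)%nat -> infinite_order (a i)) /\
            (forall i, (i < L)%nat -> infinite_order (b i))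
  | Some n => ((exists i, (i < L)%nat /\ has_order (a i) n) \/
               (exists i, (i < L)%nat /\ has_order (b i) n)) /\
              (forall i k, (i < L)%nat -> has_order (a i) k -> (n <= k)%nat) /\
              (forall i k, (i < L)%nat -> has_order (b i) k -> (n <= k)%nat)
  end.

Definition inv_ext (N : option nat) : R :=
  match N with None => 0 | Some n => / INR n end.

(* Main.v *)
(** If [g^n] is a product of [k] commutators, a surface of genus [k] with one boundary component
    maps to [G] with boundary [g^n].  Cut along arcs, it falls into pieces mapped to [A] and pieces
    mapped to [B]; their boundaries are read off two permutations [sA], [sB] of the positions of
    [g^n] whose product is the cyclic successor, and an Euler characteristic count gives at least
    [n * L + 1 - 2 * k] disks, that is, cycles whose letters have trivial product.

    Give a turn from the [i]-th letter to the [j]-th letter of [g] the weight [1 - 1/N] when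
    [i < j] and [1/N] otherwise.  A disk has weight at least [1]: if it has an ascent it also has a
    descent, and if it has none it reads a power of a single letter, hence at least [N] letters.
    An [A]-turn [i -> j] is glued to the [B]-turn [j - 1 -> i], so that a glued pair has weight [1],
    except for [j] the first letter where it has weight [2/N].  The total weight
    [n * (L - 1) + 2 * n / N] bounds the number of disks, whence [2 * k >= n + 1 - 2 * n / N].

    The surface is built from a disk by splitting its boundary and gluing each conjugate of [x] to
    the matching conjugate of [x^-1]; [x] is first made cyclically reduced and nontrivial, which
    is what prevents the gluing from producing closed spheres. *)
Require Import Defs.
From Stdlib Require Import Reals List Arith Lra Lia ClassicalEpsilon.
From mathcomp Require all_boot all_fingroup zify boolp.
Open Scope R_scope.

Module Fillings.
Import all_boot all_fingroup zify boolp Defs.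
Set Warnings "-notation-overridden".
Set Implicit Arguments.
Unset Strict Implicit.
Unset Printing Implicit Defensive.
Local Open Scope group_scope.
Local Open Scope nat_scope.

Local Notation "x ** y" := (Defs.gmul x y) (at level 40, left associativity).
Local Notation e1 := Defs.gone.
Local Notation iv := Defs.ginv.

(** * Identities in an arbitrary group *)

Lemma gmulI (A : Group) (x y z : A) : x ** y = x ** z -> y = z.
Proof.
move=> h; have: iv x ** (x ** y) = iv x ** (x ** z) by rewrite h.
by rewrite !gmul_assoc !gmul_Vl !gmul_1l.
Qed.

Lemma gmulVK (A : Group) (x y : A) : x ** iv y ** y = x.
Proof. by rewrite -gmul_assoc gmul_Vl gmul_1r. Qed.

Lemma gmulKV (A : Group) (x y : A) : x ** y ** iv y = x.
Proof. by rewrite -gmul_assoc gmul_Vr gmul_1r. Qed.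

Lemma gmulKVl (A : Group) (x y : A) : iv x ** (x ** y) = y.
Proof. by rewrite gmul_assoc gmul_Vl gmul_1l. Qed.

Lemma ginvU (A : Group) (x y : A) : x ** y = e1 -> y = iv x.
Proof. by move=> h; apply: (@gmulI A x); rewrite h gmul_Vr. Qed.

Lemma ginvK (A : Group) (x : A) : iv (iv x) = x.
Proof. by apply/esym/ginvU; rewrite gmul_Vl. Qed.

Lemma ginv1 (A : Group) : iv (@gone A) = e1.
Proof. by apply/esym/ginvU; rewrite gmul_1l. Qed.

Lemma ginvM (A : Group) (x y : A) : iv (x ** y) = iv y ** iv x.
Proof. by apply/esym/ginvU; rewrite gmul_assoc gmulKV gmul_Vr. Qed.

Lemma ginv_eq1 (A : Group) (x : A) : iv x = e1 -> x = e1.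
Proof. by move=> h; rewrite -(ginvK x) h ginv1. Qed.

(** * Cycles with trivial product *)

Lemma tpermE (T : finType) (x y z : T) :
  tperm x y z = if z == x then y else if z == y then x else z.
Proof.
case: tpermP => [->|->|]; rewrite ?eqxx //; first by case: eqP.
by move=> /eqP/negPf-> /eqP/negPf->.
Qed.

Lemma mul_tpermr (T : finType) (s : {perm T}) x y :
  (s * tperm x y = tperm (s^-1 x) (s^-1 y) * s)%g.
Proof. by rewrite -tpermJ conjgE invgK !mulgA mulgKV. Qed.

Lemma mul_tperml (T : finType) (s : {perm T}) x y :
  (tperm x y * s = s * tperm (s x) (s y))%g.
Proof. by rewrite mul_tpermr !permK. Qed.

Lemma porbit_subP (T : finType) (s : {perm T}) (D : {set T}) x :
  x \in D -> (forall z, z \in D -> s z \in D) -> porbit s x \subset D.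
Proof.
move=> xD cD; apply/subsetP => z /porbitP[i ->].
by elim: i => [|i IH]; rewrite ?expg0 ?perm1 // expgSr permM; apply: cD.
Qed.

Lemma porbit_closed (T : finType) (s : {perm T}) x z :
  z \in porbit s x -> s z \in porbit s x.
Proof. by move=> /porbitP[i ->]; rewrite -permM -expgSr mem_porbit. Qed.

Lemma porbit_step (T : finType) (s : {perm T}) x : s x \in porbit s x.
Proof. by apply: porbit_closed; apply: porbit_id. Qed.

Lemma porbit_agree (T : finType) (s s' : {perm T}) x :
  {in porbit s x, s =1 s'} -> porbit s' x = porbit s x.
Proof.
move=> h; have e i : (s' ^+ i)%g x = (s ^+ i)%g x.
  elim: i => [|i IH]; rewrite ?expg0 ?perm1 // !expgSr !permM IH h //.
  exact: mem_porbit.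
by apply/setP => z; apply/porbitP/porbitP => -[i ->]; exists i; rewrite e.
Qed.

Lemma porbit_fix (T : finType) (s : {perm T}) x : s x = x -> porbit s x = [set x].
Proof.
move=> h; apply/eqP; rewrite eqEsubset sub1set porbit_id andbT.
by apply: porbit_subP => [|z]; rewrite !inE // => /eqP->; rewrite h.
Qed.

(* A potential [f] on the orbit witnesses that the cyclic product of the letters is trivial, without choosing a base point. *)
Definition good (A : Group) (T : finType) (s : {perm T}) (al : T -> A) (x : T) :=
  exists f : T -> A, {in porbit s x, forall y, f (s y) = f y ** al y}.

Definition goods (A : Group) (T : finType) (s : {perm T}) (al : T -> A) :=
  [set porbit s x | x in [set x | `[< good s al x >]]].

Definition ngood (A : Group) (T : finType) (s : {perm T}) (al : T -> A) :=
  #|goods s al|.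

Section Good.
Variables (A : Group) (T : finType).
Implicit Types (s : {perm T}) (al : T -> A).

Lemma good_sub s al (D : {set T}) x (f : T -> A) :
  x \in D -> (forall z, z \in D -> s z \in D) ->
  {in D, forall y, f (s y) = f y ** al y} -> good s al x.
Proof.
move=> xD cD h; exists f => y yx; apply: h.
exact: (subsetP (porbit_subP xD cD)).
Qed.

Lemma goodsP s al x : reflect (good s al x) (porbit s x \in goods s al).
Proof.
apply: (iffP imsetP) => [[z]|h]; last by exists x; rewrite // inE; apply/asboolP.
by rewrite inE => /asboolP[f hf] e; exists f => y; rewrite e; apply: hf.
Qed.

Lemma goods_orbit s al C : C \in goods s al -> exists2 x, C = porbit s x & good s al x.
Proof. by case/imsetP => x; rewrite inE => /asboolP h ->; exists x. Qed.

Lemma goods_agree s s' al al' x :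
  {in porbit s x, s =1 s'} -> {in porbit s x, al =1 al'} ->
  good s al x -> porbit s x \in goods s' al'.
Proof.
move=> h hal [f hf]; rewrite -(porbit_agree h); apply/goodsP; exists f => y.
by rewrite (porbit_agree h) => yx; rewrite -h // -hal // hf.
Qed.

(** The transposition splits one cycle or merges two. A split destroys at most the one cycle that is
    cut. When two good cycles merge, their union is good as well, so that the loss is again one; if
    one of the two is not good, only the other can be lost. *)
Lemma ngood_tperm s al x y : ngood s al <= (ngood (tperm x y * s)%g al).+1.
Proof.
set s' := (_ * s)%g.
have far z : good s al z -> x \notin porbit s z -> y \notin porbit s z ->
    porbit s z \in goods s' al.
  move=> gz xz yz; apply: goods_agree (gz) => // u uz.
  by rewrite permM tpermD //; [apply: contraNneq xz => ->|apply: contraNneq yz => ->].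
have step P : {subset goods s al <= P :|: goods s' al} -> #|P| <= 1 ->
    ngood s al <= (ngood s' al).+1.
  move=> /subsetP/subset_leq_card h P1; apply: leq_trans h _.
  by apply: leq_trans (leq_card_setU _ _) _; rewrite -add1n leq_add2r.
have [exy|nexy] := eqVneq (porbit s x) (porbit s y).
  apply: (step [set porbit s x]); last by rewrite cards1.
  move=> C /goods_orbit[z -> gz]; rewrite inE in_set1.
  have [xz|xz] := boolP (x \in porbit s z).
    by rewrite eq_sym eq_porbit_mem xz.
  by rewrite far ?orbT // porbit_sym -eq_porbit_mem -exy eq_porbit_mem porbit_sym.
have [gx|ngx] := pselect (good s al x); last first.
  apply: (step [set porbit s y]); last by rewrite cards1.
  move=> C /goods_orbit[z -> gz]; rewrite inE in_set1.
  have [yz|yz] := boolP (y \in porbit s z).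
    by rewrite eq_sym eq_porbit_mem yz.
  rewrite far ?orbT //; apply: contra_notN ngx; rewrite -eq_porbit_mem => /eqP e.
  by apply/goodsP; rewrite e; apply/goodsP.
have [gy|ngy] := pselect (good s al y); last first.
  apply: (step [set porbit s x]); last by rewrite cards1.
  move=> C /goods_orbit[z -> gz]; rewrite inE in_set1.
  have [xz|xz] := boolP (x \in porbit s z).
    by rewrite eq_sym eq_porbit_mem xz.
  rewrite far ?orbT //; apply: contra_notN ngy; rewrite -eq_porbit_mem => /eqP e.
  by apply/goodsP; rewrite e; apply/goodsP.
have gN : porbit s' x \in goods s' al.
  case: gx gy => [f hf] [f' hf']; apply/goodsP.
  (* Left translation by [c] keeps [f'] a potential on the cycle of [y]; its value is forced by the
     new transition from [x] to [s y]. *)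
  pose c := f x ** al x ** iv (al y) ** iv (f' y).
  pose F z := if z \in porbit s x then f z else c ** f' z.
  have dis z : z \in porbit s y -> z \in porbit s x = false.
    rewrite -eq_porbit_mem => /eqP e; apply/negP; rewrite -eq_porbit_mem e => /eqP e'.
    by rewrite e' eqxx in nexy.
  have xyN : x != y by apply: contraNneq nexy => ->.
  apply: (@good_sub _ _ (porbit s x :|: porbit s y) _ F).
  - by rewrite inE porbit_id.
  - move=> z; rewrite !inE permM tpermE.
    case: eqP => [_ _|_]; first by rewrite porbit_step orbT.
    case: eqP => [_ _|_]; first by rewrite porbit_step.
    by case/orP => /porbit_closed ->; rewrite ?orbT.
  move=> z; rewrite inE permM tpermE.
  case: eqP => [-> _|_].
    rewrite /F porbit_id dis ?porbit_step // hf' ?porbit_id // /c.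
    by rewrite gmul_assoc !gmulVK.
  case: eqP => [-> _|_].
    by rewrite /F porbit_step dis ?porbit_id // hf ?porbit_id // /c !gmulVK.
  case/orP => zz; rewrite /F.
    by rewrite zz porbit_closed // hf.
  by rewrite !dis ?porbit_closed // hf' // gmul_assoc.
have sub : {subset goods s al :\ porbit s x :\ porbit s y <= goods s' al :\ porbit s' x}.
  move=> C; rewrite !inE => /and3P[ny nx /goods_orbit[z eC gz]].
  rewrite eC in ny nx *.
  have xz : x \notin porbit s z by rewrite -eq_porbit_mem eq_sym.
  have yz : y \notin porbit s z by rewrite -eq_porbit_mem eq_sym.
  rewrite far // andbT; apply: contraNneq xz => ->; exact: porbit_id.
have := subset_leq_card (introT subsetP sub); rewrite /ngood.
rewrite [#|goods s al|](cardsD1 (porbit s x) (goods s al)) [#|goods s al :\ porbit s x|](cardsD1 (porbit s y)).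
rewrite (cardsD1 (porbit s' x) (goods s' al)) gN !inE.
by case: (porbit s x \in _); case: (_ && _) => /=; lia.
Qed.

Lemma ngood_tpermr s al x y : ngood s al <= (ngood (s * tperm x y)%g al).+1.
Proof. by rewrite mul_tpermr ngood_tperm. Qed.

(** Bypasses [x]: it becomes a fixed point, and its predecessor is sent to [s x]. *)
Definition del (x : T) s : {perm T} := (s * tperm x (s x))%g.

Lemma delE x s z : del x s z = if z == x then x else if s z == x then s x else s z.
Proof.
rewrite permM tpermE (inj_eq perm_inj).
have [->|zx] := eqVneq z x; last by [].
by case: eqP => [->|].
Qed.

Lemma del_fix x s : s x = x -> del x s = s.
Proof. by move=> h; rewrite /del h tperm1 mulg1. Qed.

(** A trivial letter does not change the potential, so the shortened cycle is good if the old one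
    was, and the isolated point [x] is one more good cycle. *)
Lemma ngood_del s al x : al x = e1 -> s x != x -> ngood s al < ngood (del x s) al.
Proof.
move=> ax sx; set s' := del x s.
have far z : good s al z -> x \notin porbit s z -> porbit s z \in goods s' al.
  move=> gz xz; apply: goods_agree (gz) => // u uz.
  rewrite delE; case: eqP => [ux|_]; first by rewrite -ux uz in xz.
  by case: eqP => [ux|//]; rewrite -ux porbit_closed in xz.
have fx : s' x = x by rewrite delE eqxx.
have gx : porbit s' x \in goods s' al.
  by apply/goodsP; exists (fun=> e1) => y; rewrite porbit_fix // inE => /eqP->; rewrite ax gmul_1r.
rewrite /ngood [#|goods s' al|](cardsD1 (porbit s' x)) gx add1n ltnS.
have [gsx|ngsx] := pselect (good s al x); last first.
  apply/subset_leq_card/subsetP => C /goods_orbit[z -> gz].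
  have xz : x \notin porbit s z.
    apply: contra_notN ngsx; rewrite -eq_porbit_mem => /eqP e.
    by apply/goodsP; rewrite e; apply/goodsP.
  by rewrite inE far // andbT inE; apply: contraNneq xz => ->; apply: porbit_id.
have xsx : x \notin porbit s' (s x).
  by rewrite porbit_sym porbit_fix // inE.
have gsx' : porbit s' (s x) \in goods s' al.
  case: gsx => f hf; apply/goodsP.
  apply: (@good_sub _ _ (porbit s x :\ x) _ f).
  - by rewrite !inE sx porbit_step.
  - move=> z; rewrite !inE => /andP[zx zo]; rewrite delE (negPf zx).
    case: ifPn => [_|->]; first by rewrite sx porbit_step.
    by rewrite porbit_closed.
  move=> z; rewrite !inE => /andP[zx zo]; rewrite delE (negPf zx) -hf //.
  by case: eqP => // ->; rewrite hf ?porbit_id // ax gmul_1r.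
rewrite [#|goods s al|](cardsD1 (porbit s x)) (introT (goodsP _ _ _) gsx) add1n.
rewrite [#|goods s' al :\ _|](cardsD1 (porbit s' (s x))) !inE gsx' andbT.
rewrite (_ : _ != _ = true); last by apply: contraNneq xsx => ->; apply: porbit_id.
rewrite add1n ltnS; apply/subset_leq_card/subsetP => C.
rewrite !inE => /andP[Cx /goods_orbit[z eC gz]]; rewrite eC in Cx *.
have xz : x \notin porbit s z by rewrite -eq_porbit_mem eq_sym.
rewrite far // andbT; apply/andP; split.
  apply: contraNneq Cx => e.
  have : s x \in porbit s z by rewrite e porbit_id.
  by rewrite -eq_porbit_mem => /eqP <-; rewrite eq_porbit_mem porbit_step.
by apply: contraNneq xz => ->; apply: porbit_id.
Qed.

Lemma ngood_del_le s al x : al x = e1 -> ngood s al <= ngood (del x s) al.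
Proof.
move=> ax; have [/del_fix->//|sx] := eqVneq (s x) x; exact/ltnW/ngood_del.
Qed.

(** A change of gauge: a potential for [al], multiplied on the right by the inverse of [h], is one
    for the new letters. One inclusion suffices, since the inverse gauge undoes [h]. *)
Lemma ngood_gauge s al (h : T -> A) :
  ngood s (fun x => h x ** al x ** iv (h (s x))) = ngood s al.
Proof.
have le al1 (k : T -> A) : ngood s al1 <= ngood s (fun x => k x ** al1 x ** iv (k (s x))).
  apply/subset_leq_card/subsetP => C /goods_orbit[z -> [f hf]].
  apply/goodsP; exists (fun x => f x ** iv (k x)) => y yz.
  by rewrite hf // !gmul_assoc gmulVK.
apply/eqP; rewrite eqn_leq le andbT.
apply: leq_trans (le _ (fun x => iv (h x))) _.
rewrite (_ : (fun _ => _) = al) //; apply/funext => x.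
by rewrite ginvK -!gmul_assoc gmul_Vl gmul_1r gmulKVl.
Qed.

Definition upd (al : T -> A) x v z := if z == x then v else al z.

Lemma updE al x v : upd al x v x = v.
Proof. by rewrite /upd eqxx. Qed.

Lemma updN al x v z : z != x -> upd al x v z = al z.
Proof. by rewrite /upd => /negPf->. Qed.

(** The gauge that is [al x] at [y] and trivial elsewhere pushes the letter of [x] forward onto [y].
    In [ngood_merger] the gauge [iv (al y)] at [y] pulls the letter of [y] back onto [x]. *)
Lemma ngood_mergel s al x y : s x = y -> x != y ->
  ngood s (upd (upd al x e1) y (al x ** al y)) = ngood s al.
Proof.
move=> sx xy; rewrite -(ngood_gauge s al (upd (fun=> e1) y (al x))).
congr ngood; apply/funext => z; rewrite /upd.
have [->|zy] := eqVneq z y.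
  have /negPf-> : s y != y by rewrite -{2}sx (inj_eq perm_inj) eq_sym.
  by rewrite ginv1 gmul_1r.
rewrite gmul_1l; have [->|zx] := eqVneq z x; first by rewrite sx eqxx gmul_Vr.
by rewrite -sx (inj_eq perm_inj) (negPf zx) ginv1 gmul_1r.
Qed.

Lemma ngood_merger s al x y : s x = y -> x != y ->
  ngood s (upd (upd al y e1) x (al x ** al y)) = ngood s al.
Proof.
move=> sx xy; rewrite -(ngood_gauge s al (upd (fun=> e1) y (iv (al y)))).
congr ngood; apply/funext => z; rewrite /upd.
have [->|zy] := eqVneq z y.
  have /negPf-> : s y != y by rewrite -{2}sx (inj_eq perm_inj) eq_sym.
  by rewrite eq_sym (negPf xy) ginv1 gmul_1r gmul_Vl.
rewrite gmul_1l; have [->|zx] := eqVneq z x; first by rewrite sx eqxx ginvK.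
by rewrite -sx (inj_eq perm_inj) (negPf zx) ginv1 gmul_1r.
Qed.

(* Glues the letter at [x] to the inverse letter at [y]: the cycles [(x u)(y v)] become [(u v)], the cycle [(x u y v)] becomes [(u)(v)], and [x], [y] become fixed points. *)
Definition glue x y s : {perm T} := del y (del x (tperm x y * s)%g).

End Good.

(** * Gluing a letter to an inverse letter *)

Local Ltac perm_cases s x y z :=
  have := permK s x; have := permK s y; have := permK s z;
  (* Innermost tests come first: one that still contains an [if] is postponed. *)
  repeat match goal with |- context [?a == ?b] =>
    lazymatch a with context [if _ then _ else _] => fail | _ =>
      case: (a =P b) => ? //= end
  end; congruence.

Section Glue.
Variables (A : Group) (T : finType).
Implicit Types (s : {perm T}) (al : T -> A).

Lemma delC x y s : del x (del y s) = del y (del x s).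
Proof.
apply/permP => z; rewrite !delE.
perm_cases s x y z.
Qed.

Lemma del_tperml x y z s : y != x -> z != x ->
  del x (tperm y z * s)%g = (tperm y z * del x s)%g.
Proof.
move=> /eqP yx /eqP zx; apply/permP => u; rewrite permM !delE !permM !tpermE.
have := permK s u; perm_cases s x y z.
Qed.

Lemma del_tpermr x y z s : y != x -> z != x ->
  del x (s * tperm y z)%g = (del x s * tperm y z)%g.
Proof.
move=> /eqP yx /eqP zx; apply/permP => u; rewrite permM !delE !permM !tpermE.
have := permK s u; perm_cases s x y z.
Qed.

Lemma del_mul x s1 s2 : s2 (s1 x) = x -> del x (s1 * s2)%g = (del x s1 * del x s2)%g.
Proof.
move=> h; apply/permP => z; rewrite permM !delE !permM h.
have := permK s2 (s1 x); have := permK s2 (s1 z); have := permK s2 x.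
perm_cases s1 x x z.
Qed.

Lemma glueC x y s : glue x y s = glue y x s.
Proof. by rewrite /glue tpermC delC. Qed.

Lemma glue_r x y s : x != y -> del y (del x (s * tperm x y)%g) = glue x y s.
Proof.
move=> /eqP xy; apply/permP => z; rewrite /glue !delE !permM !tpermE.
perm_cases s x y z.
Qed.

(** This transposition makes [y] the successor of [x], which is the position in which two inverse
    letters can be merged and cancelled. *)
Lemma glue_l x y s : x != y -> del y (del x (s * tperm (s x) y)%g) = glue x y s.
Proof.
move=> /eqP xy; apply/permP => z; rewrite /glue !delE !permM !tpermE.
perm_cases s x y z.
Qed.

Lemma updC al x y v w : x != y ->
  upd (upd al x v) y w = upd (upd al y w) x v.
Proof.
move=> xy; apply/funext => z; rewrite /upd; case: eqP => [->|//].
by rewrite eq_sym (negPf xy).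
Qed.

Lemma ngood_glue_adj s al x y : x != y -> s x = y -> al y = iv (al x) ->
  ngood s al < ngood (glue x y s) (upd (upd al x e1) y e1).
Proof.
move=> xy sx ay; rewrite -glue_l // sx tperm1 mulg1.
rewrite -(ngood_mergel al sx xy) ay gmul_Vr.
apply: leq_trans (ngood_del_le _ _); last by rewrite updE.
by apply: ngood_del; rewrite ?sx 1?eq_sym // updN // updE.
Qed.

Lemma goods_upd_fix s al x : s x = x -> {subset goods s al <= goods s (upd al x e1)}.
Proof.
move=> fx C /goods_orbit[z -> gz].
have [xz|xz] := boolP (x \in porbit s z).
  rewrite -eq_porbit_mem in xz; rewrite -(eqP xz); apply/goodsP.
  exists (fun=> e1) => y; rewrite porbit_fix // inE => /eqP->.
  by rewrite updE gmul_1r.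
by apply: goods_agree gz => // u uz; rewrite updN //; apply: contraNneq xz => <-.
Qed.

Lemma ngood_upd_fix s al x : s x = x -> ngood s al <= ngood s (upd al x e1).
Proof. by move=> fx; apply/subset_leq_card/subsetP/goods_upd_fix. Qed.

Lemma ngood_upd_fix_lt s al x : s x = x -> al x <> e1 ->
  ngood s al < ngood s (upd al x e1).
Proof.
move=> fx ax; apply/proper_card/properP; split; first exact/subsetP/goods_upd_fix.
exists (porbit s x).
  apply/goodsP; exists (fun=> e1) => y; rewrite porbit_fix // inE => /eqP->.
  by rewrite updE gmul_1r.
apply/negP => /goodsP[f /(_ x (porbit_id _ _))]; rewrite fx => h; apply: ax.
by apply: (@gmulI _ (f x)); rewrite gmul_1r -h.
Qed.

(** In general, making [y] follow [x] costs at most one good cycle, the two letters then merge into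
    a trivial one, and deleting [x] and [y] gains two. If both points are already fixed, gluing
    changes only the letters, and the gain comes from a nontrivial letter becoming trivial; with
    trivial letters both cycles would be good beforehand. *)
Lemma ngood_glue s al x y : x != y -> al y = iv (al x) ->
  (al x <> e1) \/ ~~ ((s x == x) && (s y == y)) ->
  ngood s al < ngood (glue x y s) (upd (upd al x e1) y e1).
Proof.
move=> xy ay h.
have [sx|sx] := eqVneq (s x) y; first exact: ngood_glue_adj.
have [sy|sy] := eqVneq (s y) x.
  rewrite glueC updC //; apply: ngood_glue_adj; rewrite // 1?eq_sym //.
  by rewrite ay ginvK.
have [/andP[/eqP fx /eqP fy]|nf] := boolP ((s x == x) && (s y == y)); last first.
  rewrite -glue_l //; set s1 := (s * _)%g.
  have s1x : s1 x = y by rewrite permM tpermL.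
  apply: leq_ltn_trans (ngood_tpermr s al (s x) y) _; rewrite -/s1.
  rewrite -(ngood_mergel al s1x xy) ay gmul_Vr; set al' := upd _ _ _.
  have a'x : al' x = e1 by rewrite /al' updN // updE.
  have a'y : al' y = e1 by rewrite /al' updE.
  apply: leq_ltn_trans (ngood_del a'x _) _; first by rewrite s1x eq_sym.
  apply: ngood_del => //.
  have yx : y == x = false by rewrite eq_sym (negPf xy).
  rewrite delE yx s1x permM tpermE (inj_eq perm_inj) yx.
  have [fy|fy] := eqVneq (s y) y.
    by rewrite fy eqxx andbT in nf; rewrite (negPf nf).
  by rewrite (negPf sy).
have ax : al x <> e1 by case: h => //; rewrite fx fy !eqxx.
have -> : glue x y s = s.
  apply/permP => z; rewrite /glue !delE !permM !tpermE.
  by perm_cases s x y z.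
apply: leq_trans (ngood_upd_fix_lt fx ax) _; exact: ngood_upd_fix.
Qed.

End Glue.

(** * Simultaneous gluing of disjoint pairs *)

Section GlueFamily.
Variables (A : Group) (T : finType).
Implicit Types (s : {perm T}) (al : T -> A) (X : seq T) (ps : seq (T * T)).

Definition dels X s := foldr (@del T) s X.
Definition kill al X z : A := if z \in X then e1 else al z.
Definition glues ps s := foldr (fun p s' => glue p.1 p.2 s') s ps.
Definition swaps ps : {perm T} := foldr (fun p m => tperm p.1 p.2 * m)%g 1%g ps.
(** The order within a pair is that of the two deletions in [glue]. *)
Definition slots ps : seq T := flatten [seq [:: p.2; p.1] | p <- ps].

Lemma del_dels x X s : del x (dels X s) = dels X (del x s).
Proof. by elim: X => //= y X IH; rewrite delC IH. Qed.

Lemma perm_dels X X' s : perm_eq X X' -> dels X s = dels X' s.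
Proof.
move=> XX'; apply: (@catCA_perm_ind _ (fun Z => dels X s = dels Z s) _ X) => // s1 s2 s3 ->.
rewrite /dels !foldr_cat -/(dels _ _); elim: s1 => //= x s1 ->.
by rewrite -/(dels _ _) del_dels.
Qed.

Lemma dels_fix X s x : s x = x -> dels X s x = x.
Proof.
by elim: X => //= y X IH fx; rewrite delE IH //; case: eqP.
Qed.

Lemma dels_mem X s x : x \in X -> dels X s x = x.
Proof.
elim: X => //= y X IH; rewrite inE delE; case: eqP => //= ne /IH ->.
by case: eqP.
Qed.

(** Deleting from both factors a point that the product fixes leaves the product as it is. *)
Lemma dels_mul X s1 s2 : {in X, forall x, s2 (s1 x) = x} ->
  (dels X s1 * dels X s2 = s1 * s2)%g.
Proof.
elim: X => //= x X IH h.
have e : (dels X s1 * dels X s2 = s1 * s2)%g.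
  by apply: IH => z zX; apply: h; rewrite inE zX orbT.
have hx : (s1 * s2)%g x = x by rewrite permM h // mem_head.
by rewrite -del_mul -?permM e ?del_fix.
Qed.

Lemma dels_tperml X s x y : x \notin X -> y \notin X ->
  dels X (tperm x y * s)%g = (tperm x y * dels X s)%g.
Proof.
elim: X => //= z X IH; rewrite !inE !negb_or => /andP[xz xX] /andP[yz yX].
by rewrite IH // del_tperml.
Qed.

Lemma dels_tpermr X s x y : x \notin X -> y \notin X ->
  dels X (s * tperm x y)%g = (dels X s * tperm x y)%g.
Proof.
elim: X => //= z X IH; rewrite !inE !negb_or => /andP[xz xX] /andP[yz yX].
by rewrite IH // del_tpermr.
Qed.

Lemma swapsN ps x : x \notin slots ps -> swaps ps x = x.
Proof.
elim: ps => [|p ps IH] /=; first by rewrite perm1.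
rewrite !inE !negb_or => /and3P[x2 x1 xs].
by rewrite permM tpermD 1?eq_sym // IH.
Qed.

Lemma swapsP ps x y : uniq (slots ps) -> (x, y) \in ps ->
  swaps ps x = y /\ swaps ps y = x.
Proof.
elim: ps => [|p ps IH] //=; rewrite !inE !negb_or => /and3P[/andP[p21 p2] p1 u].
case/orP => [/eqP e|xy].
  by rewrite -e /= in p21 p2 p1 *; rewrite !permM tpermL tpermR !swapsN.
have mx : (x \in slots ps) && (y \in slots ps).
  apply/andP; split; apply/flattenP; exists [:: y; x]; rewrite ?inE ?eqxx ?orbT //.
    by apply/mapP; exists (x, y).
  by apply/mapP; exists (x, y).
case/andP: mx => mx my; case: (IH u xy) => e1' e2'.
have ne z w : z \notin slots ps -> w \in slots ps -> z != w.
  by move=> zn; apply: contraTneq => <-.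
by rewrite !permM !tpermD ?ne.
Qed.

(** The transposition of one pair commutes with the deletion of the slots of the others, so all
    gluings are done at once by one involution. This form serves [sB] and [dels_swapsr] serves [sA]:
    the two involutions then enclose the product [sB * sA]. *)
Lemma dels_swapsl ps s : uniq (slots ps) ->
  dels (slots ps) (swaps ps * s)%g = glues ps s.
Proof.
elim: ps => [|[x y] ps IH] /=; first by rewrite mul1g.
rewrite inE negb_or => /and3P[/andP[yx yX] xX u].
by rewrite -mulgA dels_tperml // IH.
Qed.

Lemma dels_swapsr ps s : uniq (slots ps) ->
  dels (slots ps) (s * swaps ps)%g = glues ps s.
Proof.
elim: ps => [|[x y] ps IH] /=; first by rewrite mulg1.
rewrite inE negb_or => /and3P[/andP[yx yX] xX u].
rewrite mul_tperml !swapsN // mulgA dels_tpermr // IH //.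
by rewrite glue_r // eq_sym.
Qed.

Lemma kill_cons al x X : kill al (x :: X) = upd (kill al X) x e1.
Proof. by apply/funext => z; rewrite /kill /upd inE; case: eqP. Qed.

(** Each pair gains one good cycle. The other gluings kill only letters in their own slots, so every
    pair still carries its nontrivial letters when its turn comes. *)
Lemma ngood_glues ps s al : uniq (slots ps) ->
  {in ps, forall p, al p.2 = iv (al p.1) /\ al p.1 <> e1} ->
  ngood s al + size ps <= ngood (glues ps s) (kill al (slots ps)).
Proof.
elim: ps => [|[x y] ps IH] /=.
  by move=> _ _; rewrite addn0.
rewrite inE negb_or => /and3P[/andP[yx yX] xX u] h.
rewrite addnS !kill_cons.
have {}IH := IH u (fun p hp => h p (mem_behead (s := (x, y) :: ps) hp)).
apply: leq_ltn_trans IH _; have [/= h1 h2] := h _ (mem_head _ _).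
rewrite -/(slots ps) in yX xX.
by apply: ngood_glue; rewrite 1?eq_sym // /kill ?(negPf yX) (negPf xX) //; left.
Qed.

End GlueFamily.

Section Fill.
Variables A B : Group.
Local Notation word := (seq (A * B)).

(** * Fillings of cyclic words *)

Definition dead (T : finType) (sA sB : {perm T}) (al : T -> A) (be : T -> B) p :=
  [/\ sA p = p, sB p = p, al p = e1 & be p = e1].

Definition lett (T : finType) (al : T -> A) (be : T -> B) p := (al p, be p).

(* A slot [p] carries an [A]-letter followed by a [B]-letter; [cs] lists the boundary cycles. [sA p] (resp. [sB p]) is the slot whose [A]-letter (resp. [B]-letter) follows that of [p] along the boundary of a piece; gluing the pieces along turns makes [sB * sA] the boundary successor. Unused slots stay in [T] as dead ones. *)
Definition config (T : finType) (sA sB : {perm T}) (al : T -> A) (be : T -> B)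
    (cs : seq (seq T)) :=
  [/\ uniq (flatten cs),
      forall c, c \in cs -> map (sB * sA)%g c = rot 1 c &
      forall p, p \notin flatten cs -> dead sA sB al be p].

(* Each dead slot contributes two good cycles, so the inequality says that there are at least [1 - d] more disks than live slots: the surface has Euler characteristic at least [1 - d]. *)
Definition fills (T : finType) (ws : seq word) (d : nat) : Prop :=
  exists sA sB al be (cs : seq (seq T)),
    [/\ config sA sB al be cs,
        map (map (lett al be)) cs = ws &
        2 * #|T| + 1 <= ngood sA al + ngood sB be + size (flatten cs) + d].

(* Asking for all large [T] leaves room for inserting slots. *)
Definition Fill (ws : seq word) (d : nat) : Prop :=
  exists M, forall T : finType, M <= #|T| -> fills T ws d.

End Fill.

(** * Elementary moves on a filling *)

Section Moves.
Variables (A B : Group) (T : finType).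
Implicit Types (sA sB s : {perm T}) (al : T -> A) (be : T -> B) (c : seq T).
Local Notation word := (seq (A * B)).
Implicit Types (w u v : word) (ws : seq word).

(** A transposition is inserted twice between [sB] and [sA], where it cancels. On the [B]-side it
    deletes [p] and gains a good cycle, which pays for the one that may be lost on the [A]-side. *)
Lemma detach_B sA sB al be p : be p = e1 ->
  exists sA1 sB1, [/\ (sB1 * sA1 = sB * sA)%g, sB1 p = p,
    ngood sA al + ngood sB be <= ngood sA1 al + ngood sB1 be &
    forall z, z != p -> sA z = z -> sB z = z -> sA1 z = z /\ sB1 z = z].
Proof.
move=> bp; have [fp|fp] := eqVneq (sB p) p.
  by exists sA, sB; split.
exists (tperm p (sB p) * sA)%g, (sB * tperm p (sB p))%g; split.
- by rewrite -mulgA [(tperm _ _ * (_ * _))%g]mulgA tperm2 mul1g.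
- by rewrite permM tpermR.
- have := ngood_del bp fp; have := ngood_tperm sA al p (sB p).
  by rewrite /del; lia.
move=> z zp Az Bz; rewrite !permM !tpermE Bz (negPf zp).
case: eqP => // e; case/eqP: zp; apply: (@perm_inj _ sB); by rewrite Bz.
Qed.

Lemma detach_A sA sB al be q : al q = e1 ->
  exists sA1 sB1, [/\ (sB1 * sA1 = sB * sA)%g, sA1 q = q,
    ngood sA al + ngood sB be <= ngood sA1 al + ngood sB1 be &
    forall z, z != q -> sA z = z -> sB z = z -> sA1 z = z /\ sB1 z = z].
Proof.
move=> bp; have [fp|fp] := eqVneq (sA q) q.
  by exists sA, sB; split.
(* The deletion of [q] is rewritten with its transposition on the left, where it meets the one put
   to the right of [sB]. *)
have e : (tperm ((sA^-1)%g q) q * sA = del q sA)%g.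
  by rewrite /del mul_tperml permKV.
exists (del q sA), (sB * tperm ((sA^-1)%g q) q)%g; split.
- by rewrite -e -mulgA [(tperm _ _ * (_ * _))%g]mulgA tperm2 mul1g.
- by rewrite delE eqxx.
- have := ngood_del bp fp; have := ngood_tpermr sB be ((sA^-1)%g q) q.
  by lia.
move=> z zp Az Bz; rewrite delE permM !tpermE Bz Az (negPf zp).
by case: eqP => // /(congr1 sA); rewrite permKV Az => /eqP; rewrite (negPf zp).
Qed.

Lemma map_del s p c : p \notin c -> uniq c -> c != [::] ->
  map s (p :: c) = rot 1 (p :: c) -> map (del p s) c = rot 1 c.
Proof.
case: c => // q c pc uc _; rewrite !rot1_cons => e.
have [sp] : s p :: map s (q :: c) = q :: rcons c p by [].
move=> e2; have {e2} : map s (q :: c) = rcons c p by [].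
move=> e2; rewrite /del sp.
have -> : map (s * tperm p q)%g (q :: c) = map (tperm p q) (map s (q :: c)).
  by rewrite -map_comp; apply: eq_map => z /=; rewrite permM.
rewrite e2 map_rcons tpermL; congr rcons.
rewrite -[RHS]map_id; apply/eq_in_map => z zc.
rewrite tpermD //; apply: contraTneq zc => <-; last by case/andP: uc.
by move: pc; rewrite inE negb_or => /andP[].
Qed.

Lemma map_out s s' c : {in c, s =1 s'} -> map s c = rot 1 c -> map s' c = rot 1 c.
Proof. by move=> /eq_in_map ->. Qed.

Lemma map_rot1 s c z : map s c = rot 1 c -> z \in c -> s z \in c.
Proof. by move=> e zc; rewrite -(mem_rot 1) -e map_f. Qed.

Lemma mem_flatten_cons c cs (z : T) :
  (z \in flatten (c :: cs)) = (z \in c) || (z \in flatten cs).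
Proof. exact: mem_cat. Qed.

Lemma uniq_flatten_tail c (cs : seq (seq T)) : uniq (flatten (c :: cs)) -> uniq (flatten cs).
Proof. by rewrite /= cat_uniq => /and3P[]. Qed.

Lemma uniq_flatten_head c (cs : seq (seq T)) : uniq (flatten (c :: cs)) -> uniq c.
Proof. by rewrite /= cat_uniq => /and3P[]. Qed.

Lemma uniq_flatten_out c cs z : uniq (flatten (c :: cs)) -> z \in c -> z \notin flatten cs.
Proof.
rewrite /= cat_uniq => /and3P[_ /hasPn h _] zc.
by apply: contraTN (zc) => zf; apply: h.
Qed.

Lemma flatten_closed s (cs : seq (seq T)) z :
  (forall c, c \in cs -> map s c = rot 1 c) -> z \in flatten cs -> s z \in flatten cs.
Proof.
move=> h /flattenP[c ccs zc]; apply/flattenP; exists c => //.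
exact: map_rot1 (h c ccs) zc.
Qed.

(** Common ending of the moves that change only the first boundary cycle: [D] contains the slots
    that are touched, and those left out of the new cycle [c'] must be dead afterwards. *)
Lemma fills_head sA sB al be sA' sB' al' be' (D c' : seq T) cs w ws d :
  uniq c' -> {subset c' <= D} -> {in D, forall z, z \notin flatten cs} ->
  uniq (flatten cs) -> (forall c, c \in cs -> map (sB * sA)%g c = rot 1 c) ->
  {in flatten cs, (sB' * sA')%g =1 (sB * sA)%g} ->
  map (sB' * sA')%g c' = rot 1 c' ->
  (forall z, z \notin D -> al' z = al z /\ be' z = be z) ->
  (forall z, z \notin D -> z \notin flatten cs -> dead sA' sB' al be z) ->
  {in D, forall z, z \notin c' -> dead sA' sB' al' be' z} ->
  map (lett al' be') c' = w -> map (map (lett al be)) cs = ws ->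
  2 * #|T| + 1 <= ngood sA' al' + ngood sB' be' + size (c' ++ flatten cs) + d ->
  fills T (w :: ws) d.
Proof.
move=> uc' c'D Dcs ucs ccs nus nuc ab dout din wE wsE g.
exists sA', sB', al', be', (c' :: cs); split=> //; first split.
- rewrite /= cat_uniq uc' ucs andbT; apply/hasPn => z zcs.
  by apply: contraTN zcs => /c'D /Dcs.
- move=> c; rewrite inE => /orP[/eqP->//|ccs'].
  rewrite -(ccs _ ccs'); apply/eq_in_map => z zc; apply: nus.
  by apply/flattenP; exists c.
- move=> z /=; rewrite mem_cat negb_or => /andP[zc zcs].
  have [zD|zD] := boolP (z \in D); first exact: din.
  by have [? ? a1 b1] := dout z zD zcs; have [al1 be1] := ab z zD; split; rewrite ?al1 ?be1.
rewrite /= wE -wsE; congr cons; apply/eq_in_map => c ccs'.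
apply/eq_in_map => z zc; rewrite /lett.
have zD : z \notin D by apply: contraTN (introT flattenP (ex_intro2 _ _ c ccs' zc)) => /Dcs.
by case: (ab z zD) => -> ->.
Qed.

Lemma fills_rot u v ws d : fills T ((u ++ v) :: ws) d -> fills T ((v ++ u) :: ws) d.
Proof.
move=> [sA [sB [al [be [[|c cs] [[uc cc dc] //= [ew ews] gd]]]]]].
have pe : perm_eq (flatten (rot (size u) c :: cs)) (flatten (c :: cs)).
  by rewrite /= perm_cat2r perm_rot.
exists sA, sB, al, be, (rot (size u) c :: cs); split; first split.
- by rewrite (perm_uniq pe).
- move=> c'; rewrite inE => /orP[/eqP->|c'cs]; last by apply: cc; rewrite inE c'cs orbT.
  by rewrite map_rot cc ?mem_head // rot_rot.
- by move=> p; rewrite (perm_mem pe); apply: dc.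
- by rewrite /= map_rot ew rot_size_cat ews.
- by rewrite (perm_size pe).
Qed.

(** Transposing the first slots of the two parts after [sA] cuts the boundary cycle in two. At most
    one good [A]-cycle is lost, hence the increase of [d]. *)
Lemma fills_split u v ws d : 0 < size u -> 0 < size v ->
  fills T ((u ++ v) :: ws) d -> fills T (u :: v :: ws) d.+1.
Proof.
move=> u0 v0 [sA [sB [al [be [[|c cs] [[uc cc dc] //= [ew ews] gd]]]]]].
have [c1 [c2 [ec eu ev]]] : exists c1 c2,
    [/\ c = c1 ++ c2, map (lett al be) c1 = u & map (lett al be) c2 = v].
  exists (take (size u) c), (drop (size u) c); rewrite cat_take_drop.
  by rewrite map_take map_drop ew take_size_cat // drop_size_cat.
case: c1 eu ec => [eu|x c1 eu ec]; first by rewrite -eu in u0.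
case: c2 ev ec => [ev|y c2 ev ec]; first by rewrite -ev in v0.
have xyc : uniq (x :: c1 ++ y :: c2).
  by move: uc; rewrite ec cat_uniq => /andP[].
have [xc1 yc1 xc2 yc2] : [/\ x \notin c1, y \notin c1, x \notin c2 & y \notin c2].
  move: xyc; rewrite /= mem_cat inE !negb_or cat_uniq /= negb_or.
  by move=> /andP[/and3P[-> _ ->] /and4P[_ /andP[-> _] -> _]].
have /eqP := cc c (mem_head _ _).
rewrite ec map_cat cat_cons rot1_cons rcons_cat rcons_cons -cat_rcons.
rewrite eqseq_cat ?size_map ?size_rcons //.
case/andP => /eqP mu /eqP mv.
have mt z c3 : map (sB * (sA * tperm x y))%g (z :: c3) = map (tperm x y) (map (sB * sA)%g (z :: c3)).
  by rewrite -map_comp; apply: eq_map => t; rewrite mulgA permM.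
have idt c3 : x \notin c3 -> y \notin c3 -> map (tperm x y) c3 = c3.
  move=> xc3 yc3; rewrite -[RHS]map_id; apply/eq_in_map => z zc.
  by rewrite tpermD //; apply: contraTneq zc => <-.
exists (sA * tperm x y)%g, sB, al, be, ((x :: c1) :: (y :: c2) :: cs); split; first split.
- by move: uc; rewrite ec /= -!catA.
- move=> c'; rewrite !inE => /or3P[/eqP->|/eqP->|c'cs].
  + by rewrite mt mu map_rcons tpermR idt // rot1_cons.
  + by rewrite mt mv map_rcons tpermL idt // rot1_cons.
  apply: (@map_out (sB * sA)%g) => [z zc|]; last by apply: cc; rewrite inE c'cs orbT.
  have zc' : (sB * sA)%g z \in flatten cs.
    apply/flattenP; exists c' => //; apply: map_rot1 zc.
    by apply: cc; rewrite inE c'cs orbT.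
  rewrite mulgA [in RHS]permM tpermD //; move: uc; rewrite ec cat_uniq => /and3P[_ /hasPn h _].
    by apply: contraTneq (h _ zc') => <-; rewrite negbK mem_cat mem_head.
  by apply: contraTneq (h _ zc') => <-; rewrite negbK mem_cat mem_head orbT.
- move=> p pc; have [|sp tp ap bp] := dc p; first by rewrite ec /= -catA.
  split => //; rewrite permM sp tpermD //; apply: contraNneq pc => <- /=.
    by rewrite mem_head.
  by rewrite inE mem_cat mem_head !orbT.
- by rewrite /= -ews -eu -ev.
have -> : size (flatten ((x :: c1) :: (y :: c2) :: cs)) = size (c ++ flatten cs).
  by rewrite ec /= -catA.
by apply: leq_trans gd _; rewrite addnS -!addSn !leq_add2r; apply: ngood_tpermr.
Qed.

(** Once [p] is detached on the [B]-side, it is followed by [q] on the [A]-side; its letter moves to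
    [q] and [p] is deleted. The good cycle gained makes up for the boundary being one slot
    shorter. *)
Lemma fills_del1 a a' b w ws d :
  fills T ([:: (a, e1), (a', b) & w] :: ws) d -> fills T (((a ** a', b) :: w) :: ws) d.
Proof.
move=> [sA [sB [al [be [[|[|p [|q c]] cs] [[uc cc dc] //=]]]]]].
move=> [apE bp aqE bq ew ews] gd.
have [sA1 [sB1 [nuE fp g1 fix1]]] := detach_B sA sB al bp.
have mc := cc _ (mem_head _ _).
have uq : uniq (p :: q :: c) by move: uc; rewrite cat_uniq => /andP[].
have pqc : p \notin q :: c by case/andP: uq.
have pq : p != q by move: pqc; rewrite inE negb_or => /andP[].
have Ap : sA1 p = q.
  by rewrite -{1}fp -permM nuE; move: mc; rewrite rot1_cons => -[].
have Aq : sA1 p != p by rewrite Ap eq_sym.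
have dnu : (sB1 * del p sA1 = del p (sB * sA))%g.
  by rewrite -nuE /del permM fp mulgA.
have cc' c' : c' \in cs -> map (sB * sA)%g c' = rot 1 c'.
  by move=> c'cs; apply: cc; rewrite inE c'cs orbT.
have out := uniq_flatten_out uc.
apply: (@fills_head sA sB al be (del p sA1) sB1 (upd (upd al p e1) q (al p ** al q)) be
  [:: p, q & c] (q :: c) cs) => //.
- by case/andP: uq.
- by move=> z zc; rewrite inE zc orbT.
- exact: uniq_flatten_tail uc.
- move=> z zcs; rewrite dnu delE.
  have pcs := out p (mem_head _ _); case: eqP => [zp|_]; first by rewrite -zp zcs in pcs.
  by case: eqP => // zp; rewrite -zp (flatten_closed cc') in pcs.
- by rewrite dnu; apply: map_del mc => //; case/andP: uq.
- by move=> z; rewrite !inE !negb_or => /and3P[zp zq _]; rewrite !updN.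
- move=> z zD zcs; have zp : z != p by apply: contraNneq zD => ->; rewrite mem_head.
  have [|A1 B1 a1 b1] := dc z; first by rewrite mem_flatten_cons negb_or zD.
  have [A1' B1'] := fix1 z zp A1 B1.
  by split=> //; rewrite delE A1' (negPf zp).
- move=> z; rewrite inE => /orP[/eqP->|->//] _.
  by split=> //; rewrite ?delE ?eqxx // updN // updE.
- rewrite /= {1}/lett updE apE aqE bq; congr cons; rewrite -ew.
  apply/eq_in_map => z zc; rewrite /lett !updN //.
    by apply: contraNneq pqc => <-; rewrite inE zc orbT.
  by case/and3P: uq => _ + _; apply: contraNneq => <-.
have := ngood_del (s := sA1) (x := p) (al := upd (upd al p e1) q (al p ** al q)).
rewrite updN // updE ngood_mergel // => /(_ erefl Aq).
by move: gd g1 => /=; lia.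
Qed.

Lemma del_mull q s1 s2 : s2 q = q -> (del q s1 * s2 = del q (s1 * s2))%g.
Proof.
move=> h; apply/permP => z; rewrite permM !delE !permM.
have -> : (s2 (s1 z) == q) = (s1 z == q) by rewrite -{1}h (inj_eq perm_inj).
by case: (z =P q) => // _; case: eqP.
Qed.

Lemma fills_del2 a b b' w ws d :
  fills T ([:: (a, b), (e1, b') & w] :: ws) d -> fills T (((a, b ** b') :: w) :: ws) d.
Proof.
move=> [sA [sB [al [be [[|[|p [|q c]] cs] [[uc cc dc] //=]]]]]].
move=> [apE bp aqE bq ew ews] gd.
have [sA1 [sB1 [nuE fq g1 fix1]]] := detach_A sA sB be aqE.
have mc := cc _ (mem_head _ _).
have uq : uniq (p :: q :: c) by move: uc; rewrite cat_uniq => /andP[].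
have [pq pc qc uc'] : [/\ p != q, p \notin c, q \notin c & uniq c].
  by move: uq; rewrite /= inE negb_or => /and3P[/andP[]].
have qp : q != p by rewrite eq_sym.
have Bp : sB1 p = q.
  apply: (@perm_inj _ sA1); rewrite -permM nuE fq.
  by move: mc; rewrite rot1_cons => -[].
have Bq : sB1 q != q by rewrite -{2}Bp (inj_eq perm_inj) eq_sym.
have dnu : (del q sB1 * sA1 = del q (sB * sA))%g by rewrite del_mull // nuE.
have cc' c' : c' \in cs -> map (sB * sA)%g c' = rot 1 c'.
  by move=> c'cs; apply: cc; rewrite inE c'cs orbT.
have out := uniq_flatten_out uc.
apply: (@fills_head sA sB al be sA1 (del q sB1) al (upd (upd be q e1) p (be p ** be q))
  [:: p, q & c] (p :: c) cs) => //.
- by rewrite /= pc.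
- by move=> z; rewrite !inE => /orP[->|->] //; rewrite !orbT.
- exact: uniq_flatten_tail uc.
- move=> z zcs; rewrite dnu delE.
  have qcs : q \notin flatten cs by apply: out; rewrite !inE eqxx orbT.
  case: eqP => [zp|_]; first by rewrite -zp zcs in qcs.
  by case: eqP => // zp; rewrite -zp (flatten_closed cc') in qcs.
(* [map_del] removes the head of a cycle, so the cycle is rotated to begin with [q]. *)
- rewrite dnu; apply: (@rot_inj 1); rewrite -map_rot rot1_cons.
  apply: map_del; first by rewrite mem_rcons inE negb_or eq_sym pq.
  + by rewrite rcons_uniq pc.
  + by case: (c).
  by rewrite -rcons_cons -rot1_cons map_rot mc.
- by move=> z; rewrite !inE !negb_or => /and3P[zp zq _]; rewrite !updN.
- move=> z zD zcs; have zq : z != q.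
    by apply: contraNneq zD => ->; rewrite !inE eqxx orbT.
  have [|A1 B1 a1 b1] := dc z; first by rewrite mem_flatten_cons negb_or zD.
  have [A1' B1'] := fix1 z zq A1 B1.
  by split=> //; rewrite delE B1' (negPf zq).
- move=> z; rewrite !inE negb_or.
  case/or3P => [->//|/eqP-> _|->]; last by rewrite andbF.
  by split=> //; rewrite ?delE ?eqxx // (updN _ _ qp) updE.
- rewrite /= {1}/lett updE apE bp bq; congr cons; rewrite -ew.
  apply/eq_in_map => z zc; rewrite /lett !updN //.
    by apply: contraNneq qc => <-.
  by apply: contraNneq pc => <-.
have := ngood_del (s := sB1) (x := q) (al := upd (upd be q e1) p (be p ** be q)).
rewrite (updN _ _ qp) updE ngood_merger // => /(_ erefl Bq).
by move: gd g1 => /=; lia.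
Qed.

Lemma exists_dead (cs : seq (seq T)) ws (f : T -> A * B) :
  map (map f) cs = ws -> size (flatten ws) < #|T| -> exists p, p \notin flatten cs.
Proof.
move=> <-; rewrite -map_flatten size_map => h.
have [/forallP all|/forallPn[p ?]] := boolP [forall p, p \in flatten cs]; last by exists p.
have : #|T| <= #|flatten cs| by apply/subset_leq_card/subsetP => p _; apply: all.
by have := card_size (flatten cs); lia.
Qed.

(** A dead slot is spliced in before [q] on the [A]-side. This loses at most one good cycle,
    compensated by the longer boundary; merging the two new letters recovers the old labelling, so
    splitting the letter costs nothing more. *)
Lemma fills_ins1 a a' b w ws d : size (flatten (((a ** a', b) :: w) :: ws)) < #|T| ->
  fills T (((a ** a', b) :: w) :: ws) d -> fills T ([:: (a, e1), (a', b) & w] :: ws) d.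
Proof.
move=> sz [sA [sB [al [be [[|[|q c] cs] [[uc cc dc] //]]]]]].
move=> wE gd; have [p pcs] := exists_dead wE sz; move: wE => /= [aq bq ew ews].
have [Ap Bp ap bp] := dc p pcs.
move: pcs; rewrite mem_flatten_cons inE !negb_or => /andP[/andP[pq pc] pcs].
have cc' c' : c' \in cs -> map (sB * sA)%g c' = rot 1 c'.
  by move=> c'cs; apply: cc; rewrite inE c'cs orbT.
have mc := cc _ (mem_head _ _); have out := uniq_flatten_out uc.
have qcs := out q (mem_head _ _).
have /andP[qc uc']  := uniq_flatten_head uc.
apply: (@fills_head sA sB al be (sA * tperm p q)%g sB (upd (upd al p a) q a') be
  [:: p, q & c] [:: p, q & c] cs) => //.
- by rewrite /= inE negb_or pq pc qc.
- by move=> z; rewrite inE => /orP[/eqP->|/out].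
- exact: uniq_flatten_tail uc.
- move=> z zcs; rewrite mulgA [LHS]permM.
  have nz := flatten_closed cc' zcs.
  by rewrite tpermD //; apply: contraTneq nz => <-.
- have -> (l : seq T) : map (sB * (sA * tperm p q))%g l = map (tperm p q) (map (sB * sA)%g l).
    by rewrite -map_comp; apply: eq_map => t; rewrite mulgA permM.
  rewrite -[map (sB * sA)%g _]/((sB * sA)%g p :: map (sB * sA)%g (q :: c)) mc permM Bp Ap.
  rewrite !rot1_cons map_cons tpermL map_rcons tpermR.
  rewrite rcons_cons; congr (_ :: rcons _ _); rewrite -[RHS]map_id; apply/eq_in_map => z zc.
  by rewrite tpermD //; apply: contraTneq zc => <-.
- by move=> z; rewrite !inE !negb_or => /and3P[zp zq _]; rewrite !updN.
- move=> z zD zcs; have [zp zq zc] : [/\ z != p, z != q & z \notin c].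
    by move: zD; rewrite !inE !negb_or => /and3P[].
  have [|A1 B1 a1 b1] := dc z; first by rewrite mem_flatten_cons negb_or inE negb_or zq zc.
  by split=> //; rewrite permM A1 tpermD // eq_sym.
- by move=> z ->.
- rewrite /= /lett !updE bp bq updN // updE -ew; congr [:: _, _ & _].
  apply/eq_in_map => z zc; rewrite !updN //.
    by apply: contraNneq pc => <-.
  by apply: contraNneq qc => <-.
have := ngood_tpermr sA al p q.
have Ap' : (sA * tperm p q)%g p = q by rewrite permM Ap tpermL.
rewrite -(ngood_mergel (upd (upd al p a) q a') Ap') // updE updN // updE.
have -> : upd (upd (upd (upd al p a) q a') p e1) q (a ** a') = al.
  apply/funext => z; rewrite /upd; case: eqP => [->//|_]; case: eqP => [->//|//].
by move: gd => /=; lia.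
Qed.

Lemma fills_ins2 a b b' w ws d : size (flatten (((a, b ** b') :: w) :: ws)) < #|T| ->
  fills T (((a, b ** b') :: w) :: ws) d -> fills T ([:: (a, b), (e1, b') & w] :: ws) d.
Proof.
move=> sz [sA [sB [al [be [[|[|p c] cs] [[uc cc dc] //]]]]]].
move=> wE gd; have [q qcs] := exists_dead wE sz; move: wE => /= [ap bp ew ews].
have [Aq Bq aq bq] := dc q qcs.
move: qcs; rewrite mem_flatten_cons inE !negb_or => /andP[/andP[qp qc] qcs].
have cc' c' : c' \in cs -> map (sB * sA)%g c' = rot 1 c'.
  by move=> c'cs; apply: cc; rewrite inE c'cs orbT.
have mc := cc _ (mem_head _ _); have out := uniq_flatten_out uc.
have pcs := out p (mem_head _ _).
have /andP[pc uc']  := uniq_flatten_head uc.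
apply: (@fills_head sA sB al be sA (tperm p q * sB)%g al (upd (upd be q b') p b)
  [:: p, q & c] [:: p, q & c] cs) => //.
- by rewrite /= inE negb_or eq_sym qp pc qc.
- by move=> z; rewrite !inE => /or3P[/eqP->|/eqP->|zc] //; apply: out; rewrite inE zc orbT.
- exact: uniq_flatten_tail uc.
- move=> z zcs; rewrite -mulgA [LHS]permM.
  by rewrite tpermD //; apply: contraTneq zcs => <-.
- have mc' : (sB * sA)%g p :: map (sB * sA)%g c = rcons c p.
    by rewrite -rot1_cons -mc.
  rewrite -mulgA rot1_cons rcons_cons -mc' /= !permM tpermL tpermR Bq Aq.
  congr [:: _, _ & _].
  apply/eq_in_map => z zc; rewrite !permM tpermD //; apply: contraTneq zc => <- //.
- by move=> z; rewrite !inE !negb_or => /and3P[zp zq _]; rewrite !updN.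
- move=> z zD zcs; have [zp zq zc] : [/\ z != p, z != q & z \notin c].
    by move: zD; rewrite !inE !negb_or => /and3P[].
  have [|A1 B1 a1 b1] := dc z; first by rewrite mem_flatten_cons negb_or inE negb_or zp zc.
  by split=> //; rewrite permM tpermD ?B1 // eq_sym.
- by move=> z ->.
- rewrite /= /lett !updE ap aq updN // updE -ew; congr [:: _, _ & _].
  apply/eq_in_map => z zc; rewrite !updN //.
    by apply: contraNneq qc => <-.
  by apply: contraNneq pc => <-.
have := ngood_tperm sB be p q.
have Bp' : (tperm p q * sB)%g p = q by rewrite permM tpermL Bq.
rewrite -(ngood_merger (upd (upd be q b') p b) Bp') 1?eq_sym // updE updN // updE.
have -> : upd (upd (upd (upd be q b') p b) q e1) p (b ** b') = be.
  apply/funext => z; rewrite /upd; case: eqP => [->//|_]; case: eqP => [->//|//].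
by move: gd => /=; lia.
Qed.

End Moves.

(** * Gluing a boundary word to its cyclic inverse *)

Section FillsGlue.
Variables (A B : Group) (T : finType).
Implicit Types (sA sB s : {perm T}) (al : T -> A) (be : T -> B) (c xs ys : seq T).
Local Notation word := (seq (A * B)).

Lemma perm_slots xs ys : size xs = size ys ->
  perm_eq (slots (zip xs ys)) (xs ++ ys).
Proof.
elim: xs ys => [|x xs IH] [|y ys] //= [h].
apply/seq.permP => p; have /seq.permP/(_ p) := IH ys h.
by rewrite /= !count_cat /= /slots => ->; lia.
Qed.

Lemma mem_zipr s xs ys x y : size xs = size ys ->
  (x, y) \in zip xs ys -> (x, s y) \in zip xs (map s ys).
Proof.
move=> h /(map_f (fun p => (p.1, s p.2))).
by elim: xs ys h => [|x' xs IH] [|y' ys] //= [h]; rewrite !inE => /orP[->//|/(IH _ h)->]; rewrite orbT.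
Qed.

Lemma mem_zipl s xs ys x y : size xs = size ys ->
  (x, y) \in zip xs ys -> (s x, y) \in zip (map s xs) ys.
Proof.
move=> h /(map_f (fun p => (s p.1, p.2))).
by elim: xs ys h => [|x' xs IH] [|y' ys] //= [h]; rewrite !inE => /orP[->//|/(IH _ h)->]; rewrite orbT.
Qed.

Lemma zip_rot1 (S U : Type) (s : seq S) (t : seq U) : size s = size t ->
  zip (rot 1 s) (rot 1 t) = rot 1 (zip s t).
Proof. by case: s t => [|x s] [|y t] //= [h]; rewrite !rot1_cons zip_rcons. Qed.

Lemma zip_fst_mem xs ys x : size xs = size ys -> x \in xs -> exists y, (x, y) \in zip xs ys.
Proof.
elim: xs ys => [|x' xs IH] [|y ys] //= [h]; rewrite inE => /orP[/eqP->|xx].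
  by exists y; rewrite mem_head.
by have [y' hy'] := IH _ h xx; exists y'; rewrite inE hy' orbT.
Qed.

Lemma zip_snd_mem xs ys y : size xs = size ys -> y \in ys -> exists x, (x, y) \in zip xs ys.
Proof.
elim: xs ys => [|x' xs IH] [|y' ys] //= [h]; rewrite inE => /orP[/eqP->|xx].
  by exists x'; rewrite mem_head.
by have [x hx] := IH _ h xx; exists x; rewrite inE hx orbT.
Qed.

Lemma kill_perm (G : Group) (al : T -> G) (X Y : seq T) : perm_eq X Y -> kill al X = kill al Y.
Proof. by move=> h; apply/funext => z; rewrite /kill (perm_mem h). Qed.

(** Gluing multiplies [sA] and [sB] by the pairings [mA] and [mB] and deletes the paired slots. The
    product becomes [mB * nu * mA], which fixes every paired slot, so the deletions do not disturb
    the other boundary cycles. *)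
Lemma fills_glue_core sA sB al be c xs ys cs d :
  config sA sB al be [:: c, rev ys, xs & cs] -> size xs = size ys ->
  2 * #|T| + 1 <= ngood (glues (zip xs ys) sA) (kill al (xs ++ ys))
    + ngood (glues (zip xs (rot 1 ys)) sB) (kill be (xs ++ ys)) + size (flatten (c :: cs)) + d ->
  fills T (map (map (lett al be)) (c :: cs)) d.
Proof.
move=> [uc cc dc] sz g; set X := xs ++ ys.
have sz' : size xs = size (rot 1 ys) by rewrite size_rot.
have pA := perm_slots sz.
have pB : perm_eq (slots (zip xs (rot 1 ys))) X.
  by apply: perm_trans (perm_slots sz') _; rewrite perm_cat2l perm_rot.
have pX : perm_eq (flatten [:: c, rev ys, xs & cs]) (X ++ (c ++ flatten cs)).
  by apply/seq.permP => p; rewrite /= !count_cat count_rev; lia.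
have := uc; rewrite (perm_uniq pX) cat_uniq => /and3P[uX /hasPn disX _].
have uA : uniq (slots (zip xs ys)) by rewrite (perm_uniq pA).
have uB : uniq (slots (zip xs (rot 1 ys))) by rewrite (perm_uniq pB).
set nu := (sB * sA)%g in cc.
set mA := swaps (zip xs ys); set mB := swaps (zip xs (rot 1 ys)).
have mx : map nu xs = rot 1 xs by apply: cc; rewrite !inE eqxx !orbT.
have my : map nu (rot 1 ys) = ys.
  have := cc (rev ys); rewrite !inE eqxx orbT => /(_ isT) /(congr1 rev).
  by rewrite map_rev rev_rot !revK => e; rewrite map_rot e rotrK.
have mAN z : z \notin X -> mA z = z.
  by move=> zX; apply: swapsN; rewrite (perm_mem pA).
have mBN z : z \notin X -> mB z = z.
  by move=> zX; apply: swapsN; rewrite (perm_mem pB).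
(* With cyclic indices, [mB] exchanges [x_i] with [y_(i+1)], [mA] exchanges [x_i] with [y_i], and
   [nu] moves forwards along [xs] but backwards along [ys]; the three maps in succession return to
   the start. *)
have cyc : {in X, forall z, (sA * mA)%g ((mB * sB)%g z) = z}.
  have pairs x y : (x, y) \in zip xs (rot 1 ys) ->
      mA (nu (mB x)) = x /\ mA (nu (mB y)) = y.
    move=> xy; have [e1' e2'] := swapsP uB xy.
    rewrite /mB e1' e2'.
    have := mem_zipr nu sz' xy; rewrite my => /(swapsP uA)[_ ->].
    by have := mem_zipl nu sz' xy; rewrite mx zip_rot1 // mem_rot => /(swapsP uA)[-> _].
  move=> z; rewrite mem_cat !permM => /orP[zx|zy].
    by have [y /pairs[+ _]] := zip_fst_mem sz' zx; rewrite permM.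
  rewrite -(mem_rot 1) in zy.
  by have [x /pairs[_ +]] := zip_snd_mem sz' zy; rewrite permM.
have EA : glues (zip xs ys) sA = dels X (sA * mA)%g.
  by rewrite -dels_swapsr // (perm_dels _ pA).
have EB : glues (zip xs (rot 1 ys)) sB = dels X (mB * sB)%g.
  by rewrite -dels_swapsl // (perm_dels _ pB).
have EN z : z \notin X -> nu z \notin X ->
    (glues (zip xs (rot 1 ys)) sB * glues (zip xs ys) sA)%g z = nu z.
  move=> zX nzX; rewrite EA EB dels_mul // !permM mBN // mAN //.
  by move: nzX; rewrite permM.
have memU z : z \in flatten [:: c, rev ys, xs & cs] = [|| z \in c, z \in X | z \in flatten cs].
  by rewrite (perm_mem pX) !mem_cat orbCA -!orbA; do ![case: (_ \in _)].
have dis z : z \in c \/ z \in flatten cs -> z \notin X.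
  by move=> zc; apply: disX; rewrite mem_cat; case: zc => ->; rewrite ?orbT.
have cs_in c' z : c' \in c :: cs -> z \in c' -> z \notin X.
  rewrite inE => /orP[/eqP->|c'cs] zc; apply: dis; [by left|right].
  by apply/flattenP; exists c'.
have cc1 c' : c' \in c :: cs -> map nu c' = rot 1 c'.
  by move=> h; apply: cc; move: h; rewrite !inE => /orP[->|->]; rewrite ?orbT.
have nuE c' : c' \in c :: cs ->
    {in c', (glues (zip xs (rot 1 ys)) sB * glues (zip xs ys) sA)%g =1 nu}.
  move=> c'cs z zc; apply: EN; first exact: cs_in zc.
  by apply: (cs_in c') => //; apply: map_rot1 (cc1 _ c'cs) zc.
apply: (@fills_head _ _ _ sA sB al be (glues (zip xs ys) sA) (glues (zip xs (rot 1 ys)) sB)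
  (kill al X) (kill be X) (c ++ X) c cs) => //.
- exact: uniq_flatten_head uc.
- by move=> z zc; rewrite mem_cat zc.
- move=> z; rewrite mem_cat => /orP[zc|zX].
    by have := uniq_flatten_out uc zc; rewrite !mem_flatten_cons !negb_or => /and3P[].
  by apply: contraTN zX => zcs; apply: dis; right.
- exact: uniq_flatten_tail (uniq_flatten_tail (uniq_flatten_tail uc)).
- by move=> c' c'cs; apply: cc1; rewrite inE c'cs orbT.
- by move=> z /flattenP[c' c'cs zc]; apply: (nuE c') => //; rewrite inE c'cs orbT.
- by rewrite -(cc1 c (mem_head _ _)); apply/eq_in_map/nuE/mem_head.
- by move=> z; rewrite mem_cat negb_or => /andP[_ zX]; rewrite /kill (negPf zX).
- move=> z; rewrite mem_cat negb_or => /andP[zc zX] zcs.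
  have [|Az Bz a b] := dc z; first by rewrite memU !negb_or zc zX.
  by split=> //; rewrite ?EA ?EB dels_fix // permM ?mBN ?Az ?mAN.
- move=> z; rewrite mem_cat => /orP[->//|zX] _.
  by split; rewrite ?EA ?EB ?dels_mem // /kill zX.
- apply/eq_in_map => z zc; rewrite /lett /kill.
  by rewrite (negPf (dis z (or_introl zc))).
Qed.

(* As a cyclic word in slots, the inverse of [a_0 b_0 ... a_r b_r] reads [a_r^-1 b_(r-1)^-1 ... a_0^-1 b_r^-1]: the [B]-letters are shifted by one slot. *)
Definition cinv (C : word) : word :=
  rev (zip (map (fun p => iv p.1) C) (rotr 1 (map (fun p => iv p.2) C))).

(** The first case is an alternating, cyclically reduced word. The second admits a single slot with
    one trivial letter, as is needed for conjugates of elements of a factor. *)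
Definition reduced (C : word) : Prop :=
  all (fun p => `[< p.1 <> e1 /\ p.2 <> e1 >]) C \/
  (exists a b, C = [:: (a, b)] /\ (a <> e1 \/ b <> e1)).

Lemma ngood_glue_fix (G : Group) s (al : T -> G) x y : x != y -> s x = x -> s y = y ->
  ngood s al <= ngood (glue x y s) (upd (upd al x e1) y e1) /\
  (al x <> e1 -> al y <> e1 ->
   ngood s al + 2 <= ngood (glue x y s) (upd (upd al x e1) y e1)).
Proof.
move=> xy fx fy; have -> : glue x y s = s.
  apply/permP => z; rewrite /glue !delE !permM !tpermE.
  by have /eqP := xy; perm_cases s x y z.
split; first exact: leq_trans (ngood_upd_fix al fx) (ngood_upd_fix _ fy).
move=> ax ay; rewrite addn2; apply: leq_ltn_trans (ngood_upd_fix_lt fx ax) _.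
by apply: ngood_upd_fix_lt; rewrite ?updN // eq_sym.
Qed.

(** The boundary shrinks by twice the length of [C], so a gain of one good cycle per pair and per
    factor keeps the balance. For a single slot, either both slots are isolated and a side with a
    nontrivial letter gains two on its own, or they are not and each side gains one. *)
Lemma fills_glue w C ws d : reduced C ->
  fills T [:: w, cinv C, C & ws] d -> fills T (w :: ws) d.
Proof.
move=> rC [sA [sB [al [be [[|c [|ys' [|xs cs]]] [cfg //]]]]]].
have [ys eys] : exists ys, ys' = rev ys by exists (rev ys'); rewrite revK.
subst ys' => -[ew eC' eC ews] g.
have uc : uniq (flatten [:: c, rev ys, xs & cs]) by case: cfg.
move/(congr1 rev): eC'; rewrite map_rev revK /cinv revK => eC'.
have sz : size xs = size ys.
  rewrite -(size_map (lett al be) ys) eC' -eC size_zip size_rotr !size_map; lia.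
have szm : size (map (fun p : A * B => iv p.1) C) = size (rotr 1 (map (fun p : A * B => iv p.2) C)).
  by rewrite size_rotr !size_map.
have ay : map al ys = map (fun x => iv (al x)) xs.
  have := congr1 unzip1 eC'; rewrite unzip1_zip ?szm // -eC /unzip1 -!map_comp.
  by move=> h; rewrite (eq_map (g := fst \o lett al be)) // h.
have by_ : map be (rot 1 ys) = map (fun x => iv (be x)) xs.
  have := congr1 unzip2 eC'; rewrite unzip2_zip ?szm // -eC /unzip2 -!map_comp.
  move=> h; rewrite map_rot (eq_map (g := snd \o lett al be)) // h rotrK.
  exact: eq_map.
rewrite -ew -ews; apply: (fills_glue_core cfg sz).
have sz' : size xs = size (rot 1 ys) by rewrite size_rot.
have pA := perm_slots sz.
have pB : perm_eq (slots (zip xs (rot 1 ys))) (xs ++ ys).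
  by apply: perm_trans (perm_slots sz') _; rewrite perm_cat2l perm_rot.
have uX : uniq (xs ++ ys).
  have pX : perm_eq (flatten [:: c, rev ys, xs & cs]) ((xs ++ ys) ++ (c ++ flatten cs)).
    by apply/seq.permP => p; rewrite /= !count_cat count_rev; lia.
  by move: uc; rewrite (perm_uniq pX) cat_uniq => /and3P[].
have uA : uniq (slots (zip xs ys)) by rewrite (perm_uniq pA).
have uB : uniq (slots (zip xs (rot 1 ys))) by rewrite (perm_uniq pB).
suff : ngood sA al + ngood sB be + 2 * size xs <=
    ngood (glues (zip xs ys) sA) (kill al (xs ++ ys)) +
    ngood (glues (zip xs (rot 1 ys)) sB) (kill be (xs ++ ys)).
  by move: g; rewrite /= !size_cat size_rev -sz; lia.
have zmap (G : Group) (f : T -> G) (us vs : seq T) p : map f vs = map (fun x => iv (f x)) us ->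
    p \in zip us vs -> f p.2 = iv (f p.1).
  elim: us vs => [|u us IH] [|v vs] //= [h1 h2].
  by rewrite inE => /orP[/eqP->|/(IH _ h2)].
have zmem us vs (p : T * T) : p \in zip us vs -> p.1 \in us.
  elim: us vs => [|u us IH] [|v vs] //=; rewrite !inE => /orP[/eqP->|/IH->] //=.
    by rewrite eqxx.
  by rewrite orbT.
case: rC => [aC|[a [b [eab nab]]]].
  have nt x : x \in xs -> al x <> e1 /\ be x <> e1.
    by move: aC; rewrite -eC all_map => /allP h /h /= /asboolP.
  have := @ngood_glues _ _ (zip xs ys) sA al uA.
  have := @ngood_glues _ _ (zip xs (rot 1 ys)) sB be uB.
  rewrite (kill_perm _ pA) (kill_perm _ pB) !size_zip -sz' -sz minnn => hB hA.
  have {}hB := hB (fun p hp => conj (zmap _ _ _ _ _ by_ hp) (nt _ (zmem _ _ _ hp)).2).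
  by have := hA (fun p hp => conj (zmap _ _ _ _ _ ay hp) (proj1 (nt _ (zmem _ _ _ hp)))); lia.
move: eC; rewrite eab.
case: xs sz cfg g uc ay by_ sz' pA pB uX uA uB => [|x [|? ?]] //.
case: ys eC' => [|y [|? ?]] // eC' _ cfg _ _ [ay] [by_] _ _ _ uX _ _ [ax bx] /=.
have xy : x != y by move: uX; rewrite /= inE andbT.
have kE (G : Group) (f : T -> G) : kill f [:: x; y] = upd (upd f x e1) y e1.
  by apply/funext => z; rewrite /kill /upd !inE; case: eqP => //; case: eqP.
rewrite !kE muln1.
have nuf : sA (sB x) = x /\ sA (sB y) = y.
  case: cfg => _ cc _; split; rewrite -permM.
    by have := cc [:: x]; rewrite !inE eqxx !orbT => /(_ isT) [].
  by have := cc [:: y]; rewrite !inE eqxx !orbT => /(_ isT) [].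
(* [sA] undoes [sB] at both slots, so being fixed means the same on the two sides. *)
have fixed : (sA x == x) && (sA y == y) = (sB x == x) && (sB y == y).
  have fe z : sA (sB z) = z -> (sA z == z) = (sB z == z).
    by move=> n; rewrite -{2}n (inj_eq perm_inj) eq_sym.
  by case: nuf => /fe-> /fe->.
have [/andP[/eqP fx /eqP fy]|nf] := boolP ((sA x == x) && (sA y == y)).
  have [gx gy] : sB x = x /\ sB y = y.
    by move: fixed; rewrite fx fy !eqxx => /esym/andP[/eqP-> /eqP->].
  have [l1 l2] := ngood_glue_fix al xy fx fy; have [m1 m2] := ngood_glue_fix be xy gx gy.
  case: nab => n; rewrite -?ax -?bx in n.
    have : al y <> e1 by rewrite ay => /ginv_eq1.
    by move=> /(l2 n); lia.
  have : be y <> e1 by rewrite by_ => /ginv_eq1.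
  by move=> /(m2 n); lia.
have := ngood_glue xy ay (or_intror nf).
rewrite fixed in nf; have := ngood_glue xy by_ (or_intror nf); lia.
Qed.

End FillsGlue.

(** * Words and the free product *)

Lemma hom1 (G H : Group) (f : G -> H) : is_hom G H f -> f e1 = e1.
Proof.
by move=> h; apply: (@gmulI _ (f e1)); rewrite -h !gmul_1r.
Qed.

Lemma homV (G H : Group) (f : G -> H) x : is_hom G H f -> f (iv x) = iv (f x).
Proof. by move=> h; apply: ginvU; rewrite -h gmul_Vr hom1. Qed.

Lemma gprod_cat (G : Group) (s t : seq G) : gprod (s ++ t) = gprod s ** gprod t.
Proof. by elim: s => [|x s IH] /=; rewrite ?gmul_1l // IH gmul_assoc. Qed.

Section Words.
Variables (A B G : Group) (iA : A -> G) (iB : B -> G).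
Hypothesis free : IsFreeProduct A B G iA iB.
Local Notation word := (seq (A * B)).
Implicit Types (w u v : word) (ws : seq word).

Definition eval w : G := gprod (map (fun p => iA p.1 ** iB p.2) w).

(** A true inverse, at the price of padding by trivial letters; [cinv] has no padding but inverts
    only up to conjugation. *)
Fixpoint winv w : word :=
  if w is p :: w' then winv w' ++ [:: (e1, iv p.2); (iv p.1, e1)] else [::].

Let homA : is_hom A G iA. Proof. by case: free. Qed.
Let homB : is_hom B G iB. Proof. by case: free => _ []. Qed.

Lemma eval_cat u v : eval (u ++ v) = eval u ** eval v.
Proof. by rewrite /eval map_cat gprod_cat. Qed.

Lemma eval_cons p w : eval (p :: w) = iA p.1 ** iB p.2 ** eval w.
Proof. by []. Qed.

Lemma eval_winv w : eval (winv w) = iv (eval w).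
Proof.
elim: w => [|p w IH]; first by rewrite /eval /= ginv1.
rewrite /= eval_cat IH eval_cons !ginvM /eval /= (hom1 homA) (hom1 homB).
by rewrite gmul_1l !gmul_1r (homV _ homA) (homV _ homB).
Qed.

Section SyntacticGroup.
Variable Q : word -> Prop.
Hypothesis Q0 : forall p s, Q (p ++ (e1, e1) :: s) <-> Q (p ++ s).
Hypothesis Q1 : forall p a a' b s,
  Q (p ++ (a, e1) :: (a', b) :: s) <-> Q (p ++ (a ** a', b) :: s).
Hypothesis Q2 : forall p a b b' s,
  Q (p ++ (a, b) :: (e1, b') :: s) <-> Q (p ++ (a, b ** b') :: s).

(** The syntactic class of [w]: the contexts that complete it to a word satisfying [Q]. *)
Definition cls w : word -> word -> Prop := fun p s => Q (p ++ w ++ s).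

Lemma cls_cat w1 w1' w2 w2' : cls w1 = cls w1' -> cls w2 = cls w2' ->
  cls (w1 ++ w2) = cls (w1' ++ w2').
Proof.
move=> h1 h2; apply/funext => p; apply/funext => s; rewrite /cls -!catA.
have := congr1 (fun F => F p (w2 ++ s)) h1; rewrite /cls => ->.
by have := congr1 (fun F => F (p ++ w1') s) h2; rewrite /cls -!catA.
Qed.

Lemma cls0 : cls [:: (e1, e1)] = cls [::].
Proof. by apply/funext => p; apply/funext => s; apply/propext/Q0. Qed.

Lemma cls1 a a' b : cls [:: (a, e1); (a', b)] = cls [:: (a ** a', b)].
Proof. by apply/funext => p; apply/funext => s; apply/propext/Q1. Qed.

Lemma cls2 a b b' : cls [:: (a, b); (e1, b')] = cls [:: (a, b ** b')].
Proof. by apply/funext => p; apply/funext => s; apply/propext/Q2. Qed.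

Lemma cls_winvr w : cls (w ++ winv w) = cls [::].
Proof.
elim: w => // -[a b] w IH; set t := [:: (e1, iv b); (iv a, e1)].
have -> : ((a, b) :: w) ++ winv ((a, b) :: w) = [:: (a, b)] ++ (w ++ winv w) ++ t.
  by rewrite /= -catA.
transitivity (cls ([:: (a, b)] ++ [::] ++ t)); first by do 2 apply: cls_cat => //.
transitivity (cls ([:: (a, e1)] ++ [:: (iv a, e1)])); last first.
  by rewrite /= cls1 gmul_Vr cls0.
apply: (@cls_cat [:: (a, b); (e1, iv b)] _ [:: (iv a, e1)]) => //.
by rewrite cls2 gmul_Vr.
Qed.

Lemma cls_winvl w : cls (winv w ++ w) = cls [::].
Proof.
elim: w => // -[a b] w IH; set t := [:: (e1, iv b); (iv a, e1); (a, b)].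
have -> : winv ((a, b) :: w) ++ (a, b) :: w = winv w ++ t ++ w by rewrite /= -catA.
rewrite -IH -[in RHS](cat0s w); apply: cls_cat => //; apply: cls_cat => //.
transitivity (cls ([:: (e1, iv b)] ++ [:: (e1, b)])); last first.
  by rewrite /= cls2 gmul_Vl cls0.
apply: (@cls_cat [:: (e1, iv b)] _ [:: (iv a, e1); (a, b)]) => //.
by rewrite cls1 gmul_Vl.
Qed.

Definition synt := {F : word -> word -> Prop | exists w, F = cls w}.

Definition mk w : synt := exist _ (cls w) (ex_intro _ w erefl).

Definition rep (F : synt) : word := sval (cid (svalP F)).

Lemma synt_eq (F F' : synt) : sval F = sval F' -> F = F'.
Proof.
case: F F' => [F hF] [F' hF'] /= e; subst F'; congr exist; exact: Prop_irrelevance.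
Qed.

Lemma mk_eq w w' : cls w = cls w' -> mk w = mk w'.
Proof. by move=> h; apply: synt_eq. Qed.

Lemma cls_rep F : cls (rep F) = sval F.
Proof. by rewrite /rep; case: (cid _) => w /= ->. Qed.

Lemma cls_rep_mk w : cls (rep (mk w)) = cls w.
Proof. exact: cls_rep. Qed.

Definition syntM (F F' : synt) : synt := mk (rep F ++ rep F').
Definition syntV (F : synt) : synt := mk (winv (rep F)).

Lemma syntM_mk w w' : syntM (mk w) (mk w') = mk (w ++ w').
Proof. by apply: mk_eq; apply: cls_cat; apply: cls_rep_mk. Qed.

Lemma mk_rep F : mk (rep F) = F.
Proof. by apply: synt_eq; apply: cls_rep. Qed.

Lemma syntA F F' F'' : syntM F (syntM F' F'') = syntM (syntM F F') F''.
Proof. by rewrite -(mk_rep F) -(mk_rep F') -(mk_rep F'') !syntM_mk catA. Qed.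

Lemma synt1l F : syntM (mk [::]) F = F.
Proof. by rewrite -{1}(mk_rep F) syntM_mk mk_rep. Qed.

Lemma synt1r F : syntM F (mk [::]) = F.
Proof. by rewrite -{1}(mk_rep F) syntM_mk cats0 mk_rep. Qed.

Lemma syntVl F : syntM (syntV F) F = mk [::].
Proof. by rewrite -{2}(mk_rep F) syntM_mk; apply: mk_eq; apply: cls_winvl. Qed.

Lemma syntVr F : syntM F (syntV F) = mk [::].
Proof. by rewrite -{1}(mk_rep F) syntM_mk; apply: mk_eq; apply: cls_winvr. Qed.

Definition syntG : Group := @MkGroup synt syntM (mk [::]) syntV syntA synt1l synt1r syntVl syntVr.

(* The class of a word modulo contexts only depends on its value: [G] maps to the syntactic group by freeness. *)
Lemma syntactic w w' : eval w = eval w' -> Q w -> Q w'.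
Proof.
move=> e; have [_ [_ /(_ syntG (fun a => mk [:: (a, e1)]) (fun b => mk [:: (e1, b)]))]] := free.
case=> [x y|x y|[phi [hphi [phiA phiB]]] _].
- by rewrite /= syntM_mk; apply: mk_eq; rewrite cls1.
- by rewrite /= syntM_mk; apply: mk_eq; rewrite cls2.
have phiE u : phi (eval u) = mk u.
  elim: u => [|[a b] u IH]; first exact: (hom1 hphi).
  rewrite eval_cons !hphi phiA phiB IH /= !syntM_mk; apply: mk_eq.
  by apply: (@cls_cat [:: (a, e1); (e1, b)] [:: (a, b)]); rewrite // cls1 gmul_1r.
have : cls w = cls w' by have := phiE w; rewrite e phiE => /(congr1 sval).
move=> /(congr1 (fun F => F [::] [::])); rewrite /cls /= !cats0 => ->; exact.
Qed.

End SyntacticGroup.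

(** * Every element of the free product is the value of a word *)

Section Generated.
Definition gen := {z : G | exists w, z = eval w}.

Lemma gen_eq (x y : gen) : sval x = sval y -> x = y.
Proof.
by case: x y => [x hx] [y hy] /= e; subst y; congr exist; apply: Prop_irrelevance.
Qed.

Lemma genM_proof (x y : gen) : exists w, sval x ** sval y = eval w.
Proof.
by case: x y => [x [u hu]] [y [v hv]]; exists (u ++ v); rewrite eval_cat /= hu hv.
Qed.

Lemma genV_proof (x : gen) : exists w, iv (sval x) = eval w.
Proof. by case: x => [x [u hu]]; exists (winv u); rewrite eval_winv /= hu. Qed.

Definition genM (x y : gen) : gen := exist _ _ (genM_proof x y).
Definition genV (x : gen) : gen := exist _ _ (genV_proof x).
Definition gen1 : gen := exist _ (@gone G) (ex_intro _ [::] erefl).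

Lemma genA x y z : genM x (genM y z) = genM (genM x y) z.
Proof. by apply: gen_eq => /=; rewrite gmul_assoc. Qed.
Lemma gen1l x : genM gen1 x = x.
Proof. by apply: gen_eq => /=; rewrite gmul_1l. Qed.
Lemma gen1r x : genM x gen1 = x.
Proof. by apply: gen_eq => /=; rewrite gmul_1r. Qed.
Lemma genVl x : genM (genV x) x = gen1.
Proof. by apply: gen_eq => /=; rewrite gmul_Vl. Qed.
Lemma genVr x : genM x (genV x) = gen1.
Proof. by apply: gen_eq => /=; rewrite gmul_Vr. Qed.

Definition genG : Group := @MkGroup gen genM gen1 genV genA gen1l gen1r genVl genVr.

(** Freeness maps [G] to the subgroup of values of words. Followed by the inclusion, this map agrees
    with the identity on both factors, hence everywhere by uniqueness. *)
Lemma eval_surj z : exists w, z = eval w.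
Proof.
have wA a : exists w, iA a = eval w.
  by exists [:: (a, e1)]; rewrite /eval /= (hom1 homB) !gmul_1r.
have wB b : exists w, iB b = eval w.
  by exists [:: (e1, b)]; rewrite /eval /= (hom1 homA) gmul_1l gmul_1r.
have [_ [_ univ]] := free.
have := univ genG (fun a => exist _ _ (wA a)) (fun b => exist _ _ (wB b)).
case=> [x y|x y|[phi [hphi [phiA phiB]]] _].
- by apply: gen_eq; rewrite /= homA.
- by apply: gen_eq; rewrite /= homB.
have [_ uniq_hom] := univ G iA iB homA homB.
have h : sval (phi z) = z.
  apply: (uniq_hom (fun x => sval (phi x)) id) => // [x y|x|x].
  - by rewrite hphi.
  - by rewrite phiA.
  - by rewrite phiB.
by have [w hw] := svalP (phi z); exists w; rewrite -hw h.
Qed.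

End Generated.

End Words.

(** * Moves valid for all large sets of slots *)

Section FillMoves.
Variables (A B : Group).
Local Notation word := (seq (A * B)).
Implicit Types (w u v C : word) (ws : seq word).

(** The bound on [T] is raised so that a slot is free for an insertion. *)
Lemma Fill_lift ws d ws' d' :
  (forall T : finType, size (flatten ws) < #|T| -> fills T ws d -> fills T ws' d') ->
  Fill ws d -> Fill ws' d'.
Proof.
move=> h [M hM]; exists (M + (size (flatten ws)).+1) => T hT.
by apply: h; [lia|apply: hM; lia].
Qed.

Lemma Fill_rot u v ws d : Fill ((u ++ v) :: ws) d -> Fill ((v ++ u) :: ws) d.
Proof. by apply: Fill_lift => T _; apply: fills_rot. Qed.

Lemma Fill_split u v ws d : 0 < size u -> 0 < size v ->
  Fill ((u ++ v) :: ws) d -> Fill (u :: v :: ws) d.+1.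
Proof. by move=> u0 v0; apply: Fill_lift => T _; apply: fills_split. Qed.

Lemma Fill_move1 a a' b w ws d :
  Fill ([:: (a, e1), (a', b) & w] :: ws) d <-> Fill (((a ** a', b) :: w) :: ws) d.
Proof.
split; apply: Fill_lift => T h; first exact: fills_del1.
exact: fills_ins1.
Qed.

Lemma Fill_move2 a b b' w ws d :
  Fill ([:: (a, b), (e1, b') & w] :: ws) d <-> Fill (((a, b ** b') :: w) :: ws) d.
Proof.
split; apply: Fill_lift => T h; first exact: fills_del2.
exact: fills_ins2.
Qed.

Lemma Fill_glue w C ws d : reduced C -> Fill [:: w, cinv C, C & ws] d -> Fill (w :: ws) d.
Proof. by move=> rC; apply: Fill_lift => T _; apply: fills_glue. Qed.

Lemma Fill_le ws d d' : d <= d' -> Fill ws d -> Fill ws d'.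
Proof.
move=> dd'; apply: Fill_lift => T _ [sA [sB [al [be [cs [c1 c2 c3]]]]]].
by exists sA, sB, al, be, cs; split=> //; lia.
Qed.

Lemma ngood_1 (H : Group) (T : finType) : #|T| <= ngood (1%g : {perm T}) (fun=> @gone H).
Proof.
have -> : #|T| = #|[set porbit (1%g : {perm T}) x | x in T]|.
  rewrite card_imset // => x y; rewrite !porbit_fix ?perm1 //; exact: set1_inj.
apply/subset_leq_card/subsetP => C /imsetP[x _ ->]; apply/goodsP.
by exists (fun=> e1) => y _; rewrite gmul_1l.
Qed.

(** A disk: the identity permutations give two good cycles per slot, and the single boundary slot
    supplies the remaining unit. *)
Lemma Fill_one : Fill [:: [:: (@gone A, @gone B)]] 0.
Proof.
exists 1 => T /card_gt0P[p _].
exists 1%g, 1%g, (fun=> e1), (fun=> e1), [:: [:: p]]; split=> //; first split=> //.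
- by move=> c; rewrite inE => /eqP->; rewrite /= mulg1 perm1.
- by move=> q _; split; rewrite ?perm1.
have := ngood_1 A T; have := ngood_1 B T; rewrite /=; lia.
Qed.

End FillMoves.

(** * Absorbing commutators into a filling *)

Section FreeProduct.
Variables (A B G : Group) (iA : A -> G) (iB : B -> G).
Hypothesis free : IsFreeProduct A B G iA iB.
Local Notation word := (seq (A * B)).
Local Notation eval := (eval iA iB).
Implicit Types (w u v C : word) (ws : seq word).

Let homA : is_hom A G iA. Proof. by case: free. Qed.
Let homB : is_hom B G iB. Proof. by case: free => _ []. Qed.

Lemma Fill_cons1 w ws d : 0 < size w ->
  Fill (((e1, e1) :: w) :: ws) d <-> Fill (w :: ws) d.
Proof. by case: w => // -[a b] w _; rewrite Fill_move1 gmul_1l. Qed.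

Lemma Fill_rotE u v ws d : Fill ((u ++ v) :: ws) d <-> Fill ((v ++ u) :: ws) d.
Proof. by split; apply: Fill_rot. Qed.

(** [syntactic] is applied to fillability of the word preceded by a trivial slot. That slot keeps
    the boundary nonempty for every context, and rotation brings an inner rewriting to the front. *)
Lemma Fill_eval w w' ws d : 0 < size w -> 0 < size w' -> eval w = eval w' ->
  Fill (w :: ws) d -> Fill (w' :: ws) d.
Proof.
move=> w0 w0' e; rewrite -(Fill_cons1 ws d w0) -(Fill_cons1 ws d w0').
have ctx p s : Fill (((e1, e1) :: p ++ s) :: ws) d <-> Fill ((s ++ (e1, e1) :: p) :: ws) d.
  by rewrite -(Fill_rotE ((e1, e1) :: p) s).
apply: (@syntactic _ _ _ _ _ free (fun v => Fill (((e1, e1) :: v) :: ws) d)) => //.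
- move=> p s; rewrite (ctx p (_ :: s)) (ctx p s) cat_cons; apply: Fill_cons1.
  by rewrite size_cat /= addnS.
- by move=> p a a' b s; rewrite (ctx p (_ :: _ :: s)) (ctx p (_ :: s)) !cat_cons Fill_move1.
- by move=> p a b b' s; rewrite (ctx p (_ :: _ :: s)) (ctx p (_ :: s)) !cat_cons Fill_move2.
Qed.

(** The shift of the [B]-letters leaves the last one of [C] over on the left and [b] on the right.
    The default [iv b] of [last] makes the formula hold for the empty word. *)
Lemma eval_rev_zip C b : exists l,
  l = iB (last (iv b) (map snd C)) /\
  eval (rev (zip (map (fun p => iv p.1) C) (b :: map (fun p => iv p.2) C))) =
  l ** iv (eval C) ** iB b.
Proof.
elim: C b => [|[a c] C IH] b.
  by eexists; split; first by []; rewrite /eval /= ginv1 gmul_1r -homB gmul_Vl (hom1 homB).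
have [l [lE e]] := IH (iv c); exists l; split; first by rewrite lE /= ginvK.
rewrite [zip _ _]/= rev_cons -cats1 eval_cat e eval_cons !ginvM /eval /= gmul_1r.
by rewrite (homV _ homA) (homV _ homB) !gmul_assoc.
Qed.

Lemma zip_catr (S U : Type) (s : seq S) (t u : seq U) : size s = size t ->
  zip s (t ++ u) = zip s t.
Proof.
elim: s t => [|x s IH] [|y t] //=; first by case: u.
by move=> [h]; rewrite IH.
Qed.

Lemma eval_cinv C : exists l, eval (cinv C) = l ** iv (eval C) ** iv l.
Proof.
case/lastP: C => [|C [a b]]; first by exists e1; rewrite /eval /= ginv1 !gmul_1l.
have [l [lE e]] := eval_rev_zip (rcons C (a, b)) (iv b).
have tE : map (fun p : A * B => iv p.2) (rcons C (a, b)) =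
    rcons (map (fun p => iv p.2) C) (iv b) by rewrite map_rcons.
exists l; rewrite /cinv tE rotr1_rcons.
move: e; rewrite tE -rcons_cons -[rcons (iv b :: _) _]cats1 zip_catr; last by rewrite /= !size_map size_rcons.
by move=> ->; rewrite lE map_rcons last_rcons (homV _ homB).
Qed.

Lemma not_all_split (S : Type) (P : pred S) (s : seq S) : ~~ all P s ->
  exists (u : seq S) x (v : seq S), s = u ++ x :: v /\ ~~ P x.
Proof.
elim: s => //= x s IH; rewrite negb_and.
case: (boolP (P x)) => /= [_ /IH[u [y [v [-> h]]]]|h _].
  by exists (x :: u), y, v.
by exists [::], x, s.
Qed.

(** Induction on the length. A slot with a trivial letter is rotated to the front by a conjugation;
    it merges with its successor if the [B]-letter is trivial, and with its cyclic predecessor if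
    the [A]-letter is. *)
Lemma conj_reduced w : exists h C, eval w = h ** eval C ** iv h /\
  (eval C = e1 \/ (reduced C /\ 0 < size C)).
Proof.
elim: {w}(size w) {-2}w (leqnn (size w)) => [|n IH] w.
  case: w => // _; exists e1, [::]; split; last by left.
  by rewrite /eval /= ginv1 !gmul_1l.
move=> wn; have [aw|] := boolP (all (fun p => `[< p.1 <> e1 /\ p.2 <> e1 >]) w).
  exists e1, w; rewrite ginv1 gmul_1l gmul_1r; split=> //.
  case: (posnP (size w)) => [/size0nil->|w0]; [by left|right].
  by split=> //; left.
case/not_all_split => u [[a b] [v [wE /asboolPn nab]]].
case: (posnP (size (v ++ u))) => [/size0nil vu|vu].
  have -> : w = [:: (a, b)].
    by rewrite wE; case: (v) (u) vu => // -[].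
  exists e1, [:: (a, b)]; rewrite ginv1 gmul_1l gmul_1r; split=> //.
  have [ea|na] := pselect (a = e1); last by right; split=> //; right; exists a, b; split; [|left].
  have [eb|nb] := pselect (b = e1); last by right; split=> //; right; exists a, b; split; [|right].
  by left; rewrite ea eb /eval /= (hom1 homA) (hom1 homB) !gmul_1l.
suff [h [w' [e sz]]] : exists h w', eval w = h ** eval w' ** iv h /\ size w' <= n.
  have [h' [C [e' hC]]] := IH w' sz; exists (h ** h'), C; split=> //.
  by rewrite e e' ginvM !gmul_assoc.
have rotE : eval w = eval u ** eval ((a, b) :: v ++ u) ** iv (eval u).
  by rewrite wE -cat_cons !eval_cat !gmul_assoc gmulKV.
have szw : size w = (size (v ++ u)).+1 by rewrite wE !size_cat /= addnS addnC.
have [eb|nb] := pselect (b = e1).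
  case: (v ++ u) vu rotE szw => // -[a' b'] r _ rotE szw.
  exists (eval u), ((a ** a', b') :: r); split; last by move: wn szw => /=; lia.
  by rewrite rotE eb !eval_cons /= homA (hom1 homB) gmul_1r !gmul_assoc.
have ea : a = e1 by apply: contrapT => na; apply: nab.
case/lastP: (v ++ u) vu rotE szw => // r [a' b'] _ rotE szw.
exists (eval u ** (iv (iA a' ** iB b'))), ((a', b' ** b) :: r); split; last first.
  by move: wn szw; rewrite size_rcons /=; lia.
have [X XE] : exists X, X = iA a' ** iB b' by eexists.
rewrite -XE ginvM ginvK rotE ea.
have -> : eval ((e1, b) :: rcons r (a', b')) = iB b ** eval r ** X.
  by rewrite XE -cats1 -cat_cons eval_cat !eval_cons /= (hom1 homA) gmul_1l gmul_1r.
by rewrite eval_cons /= homB (gmul_assoc _ (iA a')) -XE !gmul_assoc gmulVK.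
Qed.

(** With [x] conjugate to a reduced [C], the commutator is a conjugate of [C] times a conjugate of
    [cinv C]. Two splittings cut these off as separate boundary cycles, each raising [d] by one;
    gluing them together is free, and the rest has the value of [w']. *)
Lemma Fill_comm w w' x y d : 0 < size w -> 0 < size w' ->
  eval w = eval w' ** comm x y -> Fill [:: w] d -> Fill [:: w'] d.+2.
Proof.
move=> w0 w0' e F.
have [wx xE] := eval_surj free x; have [h [C [hC cC]]] := conj_reduced wx.
rewrite -xE in hC.
case: cC => [C1|[rC C0]].
  apply: (@Fill_le _ _ _ d) => //; first by rewrite -addn2 leq_addr.
  apply: Fill_eval F => //; rewrite e hC C1 gmul_1r gmul_Vr /comm ginv1.
  by rewrite !gmul_1l gmul_Vr gmul_1r.
have [l lE] := eval_cinv C.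
have [H HE] := eval_surj free h.
(* The factor [iv l] compensates the conjugation by [l] in the value of [cinv C]. *)
have [K KE] := eval_surj free (y ** h ** iv l).
have cE : comm x y = eval (H ++ C ++ winv H ++ K ++ cinv C ++ winv K).
  rewrite !eval_cat !(eval_winv free) -HE -KE lE hC /comm !ginvM !ginvK !gmul_assoc.
  by rewrite !gmulVK.
have C0' : 0 < size (cinv C).
  by rewrite /cinv size_rev size_zip size_rotr !size_map minnn.
have F1 : Fill [:: (K ++ cinv C ++ winv K ++ w' ++ H ++ C ++ winv H)] d.
  have -> : K ++ cinv C ++ winv K ++ w' ++ H ++ C ++ winv H =
    (K ++ cinv C ++ winv K) ++ (w' ++ H ++ C ++ winv H) by rewrite -!catA.
  apply/Fill_rot; apply: Fill_eval F => //.
    by rewrite !size_cat; lia.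
  by rewrite e cE !eval_cat !gmul_assoc.
have F2 : Fill [:: winv H ++ K ++ cinv C ++ winv K ++ w' ++ H; C] d.+1.
  apply: Fill_split => //; first by rewrite !size_cat; lia.
  have -> : (winv H ++ K ++ cinv C ++ winv K ++ w' ++ H) ++ C =
    winv H ++ (K ++ cinv C ++ winv K ++ w' ++ H ++ C) by rewrite -!catA.
  by apply/Fill_rot; rewrite -!catA.
have F3 : Fill [:: winv K ++ w' ++ H ++ winv H ++ K; cinv C; C] d.+2.
  apply: Fill_split => //; first by rewrite !size_cat; lia.
  have -> : (winv K ++ w' ++ H ++ winv H ++ K) ++ cinv C =
    (winv K ++ w' ++ H) ++ (winv H ++ K ++ cinv C) by rewrite -!catA.
  by apply/Fill_rot; rewrite -!catA.
apply: (Fill_glue rC).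
have F4 : Fill [:: w' ++ H ++ winv H ++ K ++ winv K; cinv C; C] d.+2.
  have -> : w' ++ H ++ winv H ++ K ++ winv K = (w' ++ H ++ winv H ++ K) ++ winv K by rewrite -!catA.
  exact/Fill_rot.
apply: Fill_eval F4 => //; first by rewrite size_cat; lia.
by rewrite !eval_cat !(eval_winv free) !gmul_assoc !gmulKV.
Qed.

Lemma Fill_comms w w' (s : seq (G * G)) d : 0 < size w -> 0 < size w' ->
  eval w = eval w' ** gprod (map (fun p => comm p.1 p.2) s) ->
  Fill [:: w] d -> Fill [:: w'] (d + 2 * size s).
Proof.
elim/last_ind: s w d => [|s [x y] IH] w d w0 w0'.
  by rewrite /= gmul_1r addn0 => e; apply: Fill_eval.
rewrite map_rcons -cats1 gprod_cat gmul_assoc /= gmul_1r => e F.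
have [u uE] := eval_surj free (eval w' ** gprod (map (fun p => comm p.1 p.2) s)).
(* The intermediate word may be empty, which a leading trivial slot repairs. *)
have uE' : eval ((e1, e1) :: u) = eval u.
  by rewrite eval_cons /= (hom1 homA) (hom1 homB) !gmul_1l.
rewrite size_rcons mulnS addnA addn2; apply: (IH ((e1, e1) :: u)) => //.
  by rewrite uE' uE.
by apply: (@Fill_comm w ((e1, e1) :: u) x y) F => //; rewrite e uE' -uE.
Qed.

End FreeProduct.

(** * Counting disks *)

Lemma gpowSr (G : Group) (x : G) n : gpow x n.+1 = gpow x n ** x.
Proof.
elim: n => [|n IH]; first by rewrite /= gmul_1l gmul_1r.
by rewrite -[gpow x n.+2]/(x ** gpow x n.+1) {1}IH gmul_assoc.
Qed.

Definition torsion_free_below (G : Group) (N : nat) (x : G) :=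
  forall j, 0 < j -> j < N -> gpow x j <> e1.

Section Count.
Variables (H : Group) (T : finType) (s : {perm T}) (al : T -> H) (D : {set T}).
Variables (l : T -> nat) (a : nat -> H) (N : nat).
Hypothesis N2 : 1 < N.
Hypothesis sD : {in D, forall p, s p \in D}.
Hypothesis sN : forall p, p \notin D -> s p = p.
Hypothesis alE : {in D, forall p, al p = a (l p)}.
Hypothesis ord : {in D, forall p, torsion_free_below N (a (l p))}.

Definition ascents := [set p in D | l p < l (s p)].

(* [N] times the weight of the header; slots outside [D] are dead. *)
Definition weight p := if p \in D then (N - 2) * (l p < l (s p)) + 1 else N.

Lemma orbit_le x : {in porbit s x, forall p, l (s p) <= l p} ->
  {in porbit s x, forall p, l p <= l x}.
Proof.
move=> h p /porbitP[i ->]; elim: i => [|i IH]; first by rewrite expg0 perm1.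
rewrite expgSr permM; apply: leq_trans IH; apply: h; exact: mem_porbit.
Qed.

Lemma good_weight x : good s al x -> N <= \sum_(p in porbit s x) weight p.
Proof.
case=> f hf; have [xD|xD] := boolP (x \in D); last first.
  by rewrite porbit_fix ?sN // big_set1 /weight (negPf xD).
have CD p : p \in porbit s x -> p \in D.
  by move=> px; apply: (subsetP (porbit_subP xD sD)).
have [/existsP[p /andP[px pa]]|] := boolP [exists p, (p \in porbit s x) && (l p < l (s p))].
  rewrite (bigD1 p) //= (bigD1 (s p)) /=; last first.
    rewrite porbit_closed //=; apply: contraTneq pa => ->; by rewrite ltnn.
  rewrite /weight (CD p px) pa (CD (s p) (porbit_closed px)); lia.
rewrite negb_exists => /forallP na.
have le p : p \in porbit s x -> l (s p) <= l p.
  by move=> px; have := na p; rewrite px /= -leqNgt.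
(* A label that never rises along a cycle is constant, since each point is reached from every
   other. *)
have lE p : p \in porbit s x -> l p = l x.
  move=> px; apply/eqP; rewrite eqn_leq orbit_le //=.
  have e : porbit s p = porbit s x by apply/eqP; rewrite eq_porbit_mem.
  by apply: (@orbit_le p); rewrite e // porbit_id.
have fE i : f ((s ^+ i)%g x) = f x ** gpow (a (l x)) i.
  elim: i => [|i IH]; first by rewrite expg0 perm1 /= gmul_1r.
  have ix := mem_porbit s i x.
  by rewrite expgSr permM hf // IH alE ?CD // lE // gpowSr gmul_assoc.
(* One full turn returns to [x], so the potential makes this power trivial. *)
have one : gpow (a (l x)) #|porbit s x| = e1.
  apply: (@gmulI _ (f x)); rewrite gmul_1r -fE permX iter_porbit //.
have C0 : 0 < #|porbit s x| by rewrite lt0n card_porbit_neq0.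
apply: (@leq_trans #|porbit s x|).
  by rewrite leqNgt; apply/negP => lt; apply: (ord xD C0 lt).
rewrite -sum1_card; apply: leq_sum => p px; rewrite /weight CD //; lia.
Qed.

(** The right-hand side is the total weight; the good cycles are disjoint and each takes at least
    [N] of it. *)
Lemma count_good : N * ngood s al <= N * #|~: D| + (N - 2) * #|ascents| + #|D|.
Proof.
have -> : N * #|~: D| + (N - 2) * #|ascents| + #|D| = \sum_p weight p.
  rewrite (bigID (mem D)) /= /weight.
  rewrite (eq_bigr (fun p => (N - 2) * (l p < l (s p)) + 1)); last by move=> p ->.
  rewrite [X in _ = _ + X](eq_bigr (fun=> N)); last by move=> p /negPf->.
  rewrite big_split /= -big_distrr /= sum1_card sum_nat_const.
  have -> : #|[pred p | p \notin D]| = #|~: D| by apply: eq_card => p; rewrite !inE.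
  have -> : \sum_(p in D) (l p < l (s p)) = #|ascents|.
    rewrite -sum1_card big_mkcond [RHS]big_mkcond; apply: eq_bigr => p _.
    by rewrite inE; case: (p \in D); case: (_ < _).
  by rewrite mulnC; lia.
have triv : trivIset (goods s al).
  apply/trivIsetP => C C' /goods_orbit[x -> _] /goods_orbit[y -> _] ne.
  apply/pred0P => z /=; apply/negP => /andP[zx zy]; case/eqP: ne.
  by apply/eqP; move: zx zy; rewrite -!eq_porbit_mem => /eqP-> /eqP->.
apply: (@leq_trans (\sum_(C in goods s al) \sum_(p in C) weight p)).
  rewrite /ngood mulnC -sum_nat_const; apply: leq_sum => C /goods_orbit[x -> gx].
  exact: good_weight.
rewrite -(big_trivIset _ triv) /= [X in _ <= X](bigID (mem (cover (goods s al)))) /=.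
exact: leq_addr.
Qed.

End Count.

(** * Fillings of powers and the resulting inequality *)

Definition power_word (A B : Type) (a : nat -> A) (b : nat -> B) (L n : nat) : seq (A * B) :=
  [seq (a (i %% L), b (i %% L)) | i <- iota 0 (n * L)].

Lemma count_top L n : 0 < L -> count (fun i => i %% L != L.-1) (iota 0 (n * L)) = n * L.-1.
Proof.
move=> L0; elim: n => [|n IH]; first by rewrite !mul0n.
rewrite mulSnr iotaD count_cat IH add0n mulSnr; congr addn.
rewrite -[in iota _ _](addn0 (n * L)) iotaDl count_map.
rewrite (@eq_in_count _ _ (fun i => i != L.-1)); last first.
  move=> i; rewrite mem_iota /= => iL; by rewrite modnMDl modn_small.
have := count_predC (pred1 L.-1) (iota 0 L); rewrite size_iota.
rewrite count_uniq_mem ?iota_uniq // mem_iota /= add0n ltn_predL L0 add1n => e.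
by rewrite -[in RHS]e.
Qed.

Lemma nth_rot1 (S : Type) (x0 : S) (s : seq S) k : k < size s ->
  nth x0 (rot 1 s) k = nth x0 s (k.+1 %% size s).
Proof.
case: s => // x s; rewrite rot1_cons nth_rcons [size _]/= ltnS => ks.
have [lt|gt|->] := ltngtP k (size s).
- by rewrite modn_small.
- by rewrite leqNgt gt in ks.
by rewrite modnn.
Qed.

(** After the two weight bounds are added, the [w] dead slots count twice on either side and
    cancel. *)
Lemma disk_count_arith N L n d gA gB u v w M : 1 < N -> 0 < L -> n * L + w = M ->
  N * gA <= N * w + (N - 2) * u + n * L -> N * gB <= N * w + (N - 2) * v + n * L ->
  2 * M + 1 <= gA + gB + n * L + d -> u + v <= n * L.-1 -> N * n.+1 <= N * d + 2 * n.
Proof.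
case: N => [|[|N]] // _; case: L => // L _ <-; rewrite !subSS subn0 /= => hA hB g asc.
have := leq_mul (leqnn N) asc; have := leq_mul (leqnn N.+2) g.
nia.
Qed.

Lemma Fill_power (A B : Group) (a : nat -> A) (b : nat -> B) (L n N d : nat) :
  0 < L -> 1 < N ->
  (forall i, i < L -> torsion_free_below N (a i)) ->
  (forall i, i < L -> torsion_free_below N (b i)) ->
  Fill [:: power_word a b L n] d -> N * n.+1 <= N * d + 2 * n.
Proof.
move=> L0 N2 ha hb [M /(_ 'I_M)]; rewrite card_ord => /(_ (leqnn M)).
set T := 'I_M => -[sA [sB [al [be [[|c [|? ?]] [[uc cc dc] //]]]]]].
move=> [cE]; rewrite /= cats0 in uc dc *; rewrite [size _]/= => g.
have {}cc := cc c (mem_head _ _).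
have sc : size c = n * L by rewrite -(size_map (lett al be) c) cE size_map size_iota.
pose D := [set p in c]; pose l (p : T) := index p c %% L.
have DE p : (p \in D) = (p \in c) by rewrite inE.
have cD : #|D| = n * L by rewrite cardsE (card_uniqP uc).
have lL p : l p < L by rewrite ltn_mod.
have letE p : p \in D -> al p = a (l p) /\ be p = b (l p).
  rewrite DE => pc; have := congr1 (fun w => nth (al p, be p) w (index p c)) cE.
  rewrite (nth_map p) ?index_mem // nth_index // (nth_map 0); last first.
    by rewrite size_iota -sc index_mem.
  by rewrite nth_iota -?sc ?index_mem // => -[-> ->].
set nu := (sB * sA)%g in cc.
have lnu p : p \in D -> l (nu p) = (l p).+1 %% L.
  rewrite DE => pc; rewrite /l.
  have nuE : nu p = nth p c ((index p c).+1 %% size c).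
    have := congr1 (fun w => nth p w (index p c)) cc.
    rewrite (nth_map p) ?index_mem // nth_index // => ->.
    by rewrite nth_rot1 // index_mem.
  have c0 : 0 < size c by case: (c) pc.
  rewrite nuE index_uniq ?ltn_mod // sc modn_dvdm ?dvdn_mull //.
  by rewrite -[in LHS]addn1 -modnDml addn1.
have dead_c p : p \notin D -> sA p = p /\ sB p = p.
  by rewrite DE => /dc[].
have stA : {in D, forall p, sA p \in D}.
  move=> p pD; apply/negPn/negP => /[dup] nD /dead_c[/perm_inj e _].
  by rewrite e pD in nD.
have stB : {in D, forall p, sB p \in D}.
  move=> p pD; apply/negPn/negP => /[dup] nD /dead_c[_ /perm_inj e].
  by rewrite e pD in nD.
have gA := @count_good A T sA al D l a N N2 stA (fun p h => proj1 (dead_c p h))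
  (fun p h => proj1 (letE p h)) (fun p _ => ha _ (lL p)).
have gB := @count_good B T sB be D l b N N2 stB (fun p h => proj2 (dead_c p h))
  (fun p h => proj2 (letE p h)) (fun p _ => hb _ (lL p)).
(* Reindexing by [sB] pairs the [A]-turn out of [sB r] with the [B]-turn out of [r]. The former ends
   at [nu r], whose label follows [l r] cyclically: exactly one of the two turns ascends if [l r] is
   not the last label, and neither does if it is. *)
have asc : #|ascents sA D l| + #|ascents sB D l| <= n * L.-1.
  rewrite -!sum1_card !big_mkcond /= [X in X + _ <= _](reindex_inj (@perm_inj _ sB)) /=.
  rewrite [X in _ + X <= _]big_mkcond -big_split /= -(count_top n L0) -[in iota _ _]sc.
  have -> : count (fun i => i %% L != L.-1) (iota 0 (size c)) = count (fun p => l p != L.-1) c.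
    have <- : map (index^~ c) c = iota 0 (size c).
      case: (c) uc => // x c' u; apply: (@eq_from_nth _ 0); first by rewrite size_map size_iota.
      rewrite size_map => i ic; rewrite (nth_map x) // nth_iota // index_uniq //.
    by rewrite count_map.
  have -> : count (fun p => l p != L.-1) c = \sum_p (p \in D) * (l p != L.-1).
    rewrite -size_filter -(card_uniqP (filter_uniq _ uc)) -sum1_card big_mkcond /=.
    by apply: eq_bigr => p _; rewrite mem_filter DE; case: (p \in c); case: (_ != _).
  apply: leq_sum => r _; rewrite !inE -!DE.
  have [rD|rD] := boolP (r \in D); last first.
    by have [_ ->] := dead_c r rD; rewrite (negPf rD).
  rewrite (stB r rD) /= mul1n -permM -/nu (lnu r rD).
  have := lL r; have := lL (sB r).
  have [-> _ _|ne lt1 lt2] := eqVneq (l r) L.-1.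
    have -> : (L.-1 < l (sB r)) = false by have := lL (sB r); lia.
    by rewrite prednK // modnn.
  by rewrite modn_small; [case: ltnP; case: ltnP => /=; lia|lia].
have := cardsC D; rewrite cD card_ord -/T; rewrite sc in g; rewrite cD in gA gB.
move=> hD.
rewrite card_ord in g; exact: disk_count_arith N2 L0 hD gA gB g asc.
Qed.

Lemma ginv_comm (G : Group) (x y : G) : iv (comm x y) = comm y x.
Proof. by rewrite /comm !ginvM !ginvK. Qed.

Lemma ginv_gprod_comm (G : Group) (s : seq (G * G)) :
  iv (gprod (map (fun p => comm p.1 p.2) s)) =
  gprod (map (fun p => comm p.1 p.2) (rev (map (fun p => (p.2, p.1)) s))).
Proof.
elim: s => [|p s IH]; first by rewrite /= ginv1.
by rewrite /= rev_cons map_rcons -cats1 gprod_cat -IH /= gmul_1r ginvM ginv_comm.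
Qed.

Section FreeProduct.
Variables (A B G : Group) (iA : A -> G) (iB : B -> G).
Hypothesis free : IsFreeProduct A B G iA iB.
Variables (L : nat) (a : nat -> A) (b : nat -> B).

Lemma eval_power_word n : 0 < L ->
  eval iA iB (power_word a b L n) =
  gpow (gprod (map (fun i => iA (a i) ** iB (b i)) (iota 0 L))) n.
Proof.
move=> L0; elim: n => [|n IH]; first by rewrite /power_word mul0n.
rewrite gpowSr -IH /power_word mulSnr iotaD map_cat eval_cat; congr gmul.
rewrite add0n -[in iota _ _](addn0 (n * L)) iotaDl /eval -!map_comp; congr gprod.
by apply/eq_in_map => i; rewrite mem_iota /= => iL; rewrite modnMDl modn_small.
Qed.

(** The disk has value 1, which is the power times its inverse, and that inverse is again a product
    of commutators, in reverse order with entries exchanged. So [Fill_comms] leads from the disk to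
    [power_word], and [Fill_power] applies. *)
Lemma commutator_product_bound (N n : nat) (s : seq (G * G)) :
  0 < L -> 1 < N -> 0 < n ->
  (forall i, i < L -> torsion_free_below N (a i)) ->
  (forall i, i < L -> torsion_free_below N (b i)) ->
  gprod (map (fun p => comm p.1 p.2) s) =
    gpow (gprod (map (fun i => iA (a i) ** iB (b i)) (iota 0 L))) n ->
  N * n.+1 <= N * (2 * size s) + 2 * n.
Proof.
move=> L0 N2 n0 ha hb e.
have pw0 : 0 < size (power_word a b L n) by rewrite size_map size_iota muln_gt0 n0.
apply: (Fill_power L0 N2 ha hb).
pose s' := rev (map (fun p => (p.2, p.1)) s).
have [homA [homB _]] := free.
have -> : size s = size s' by rewrite size_rev size_map.
apply: (@Fill_comms _ _ _ _ _ free [:: (e1, e1)] _ s' 0) (Fill_one A B) => //.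
rewrite eval_power_word // -ginv_gprod_comm e gmul_Vr /eval /=.
by rewrite (hom1 homA) (hom1 homB) !gmul_1l.
Qed.

End FreeProduct.

(** The bound restated with the order relations and lists of Stdlib, for use outside the module. *)
Lemma commutator_product_bound_nat (A B G : Group) (iA : A -> G) (iB : B -> G)
  (free : IsFreeProduct A B G iA iB) (L N n : nat) (a : nat -> A) (b : nat -> B)
  (s : list (G * G)) :
  (1 <= L)%coq_nat -> (2 <= N)%coq_nat -> (1 <= n)%coq_nat ->
  (forall i j, (i < L)%coq_nat -> (0 < j)%coq_nat /\ (j < N)%coq_nat -> gpow (a i) j <> gone) ->
  (forall i j, (i < L)%coq_nat -> (0 < j)%coq_nat /\ (j < N)%coq_nat -> gpow (b i) j <> gone) ->
  gprod (List.map (fun p => comm (fst p) (snd p)) s) =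
    gpow (gprod (List.map (fun i => gmul (iA (a i)) (iB (b i))) (List.seq 0 L))) n ->
  (N * S n <= N * (2 * List.length s) + 2 * n)%coq_nat.
Proof.
move=> L0 N2 n0 ha hb e; apply/leP.
apply: (@commutator_product_bound _ _ _ _ _ free L a b N n s _ _ _ _ _ e); try exact/leP.
  move=> i /ltP iL j /ltP j0 /ltP jN; exact: (ha i j iL (conj j0 jN)).
move=> i /ltP iL j /ltP j0 /ltP jN; exact: (hb i j iL (conj j0 jN)).
Qed.

End Fillings.

(** * Commutator length and its stabilization *)

Definition comms {G : Group} (s : list (G * G)) : G :=
  gprod (map (fun p => comm (fst p) (snd p)) s).

Lemma is_prod_comms_list (G : Group) (h : G) (n : nat) :
  is_prod_comms G h n <-> exists s, length s = n /\ comms s = h.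
Proof.
split.
- intros [x [y <-]]. exists (map (fun i => (x i, y i)) (seq 0 n)).
  split; [now rewrite length_map, length_seq|].
  unfold comms. now rewrite map_map.
- intros [s [<- <-]]. revert s.
  (* The first index is generalized because the tail of the list is read from [S k] on. *)
  assert (H : forall s k, exists x y : nat -> G,
    gprod (map (fun i => comm (x i) (y i)) (seq k (length s))) = comms s).
  { intros s k.
    exists (fun i => fst (nth (i - k) s (gone, gone))), (fun i => snd (nth (i - k) s (gone, gone))).
    revert k. induction s as [|p s IH]; intros k; [reflexivity|].
    unfold comms in *. cbn [length seq map gprod]. rewrite Nat.sub_diag. cbn [nth].
    f_equal. rewrite <- (IH (S k)). f_equal. apply map_ext_in. intros i Hi.
    apply in_seq in Hi. now replace (i - k)%nat with (S (i - S k)) by lia. }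
  intros s. destruct (H s 0%nat) as [x [y Hxy]]. now exists x, y.
Qed.

Lemma comms_app (G : Group) (s t : list (G * G)) : comms (s ++ t) = gmul (comms s) (comms t).
Proof. unfold comms. rewrite map_app. apply Fillings.gprod_cat. Qed.

Lemma commutator_subgroup_comms (G : Group) (h : G) :
  in_commutator_subgroup G h -> exists s, comms s = h.
Proof.
intros [l [Hl <-]]. induction Hl as [|x l [a [b Hx]] Hl [s Hs]].
- now exists nil.
- destruct Hx as [-> | ->]; [exists ((a, b) :: s)|exists ((b, a) :: s)];
    cbn; rewrite <- Hs; [reflexivity|]. now rewrite Fillings.ginv_comm.
Qed.

Lemma gpow_add (G : Group) (x : G) m n : gpow x (m + n) = gmul (gpow x m) (gpow x n).
Proof.
induction m as [|m IH]; cbn; [now rewrite gmul_1l|]. now rewrite IH, gmul_assoc.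
Qed.

Lemma least_nat (P : nat -> Prop) n : P n -> exists m, P m /\ forall k, P k -> (m <= k)%nat.
Proof.
induction n as [n IH] using (well_founded_induction lt_wf). intros Pn.
destruct (classic (exists k, (k < n)%nat /\ P k)) as [[k [Hk Pk]]|H]; [eauto|].
exists n. split; [assumption|]. intros k Pk.
apply Nat.nlt_ge. intros Hk. apply H. now exists k.
Qed.

(** One expression as a product of commutators yields a shortest one, so that [epsilon] has a
    witness. *)
Lemma cl_is_cl (G : Group) (h : G) (s : list (G * G)) : comms s = h -> is_cl G h (cl G h).
Proof.
intros Hs. unfold cl. apply epsilon_spec. apply (least_nat _ (length s)).
apply is_prod_comms_list. now exists s.
Qed.

Lemma cl_comms (G : Group) (h : G) (s : list (G * G)) : comms s = h ->
  (exists t, length t = cl G h /\ comms t = h) /\ (cl G h <= length s)%nat.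
Proof.
intros Hs. destruct (cl_is_cl G h s Hs) as [H1 H2]. split.
- now apply is_prod_comms_list.
- apply H2, is_prod_comms_list. now exists s.
Qed.

(** Fekete's lemma: the limit is the infimum of the ratios. Division of the index by an [M] of
    nearly minimal ratio leaves a remainder whose contribution is bounded. *)
Lemma fekete (c : nat -> R) :
  (forall n, 0 <= c n) ->
  (forall m n, (1 <= m)%nat -> (1 <= n)%nat -> c (m + n)%nat <= c m + c n) ->
  exists l, Un_cv (fun n => c (S n) / INR (S n)) l.
Proof.
intros c0 sub.
set (E := fun x => exists m, x = - (c (S m) / INR (S m))).
assert (pos : forall m, 0 < INR (S m)) by (intros; apply lt_0_INR; lia).
destruct (completeness E) as [l [ub lub]].
{ exists 0. intros x [m ->]. assert (0 <= c (S m) / INR (S m)); [|lra].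
  apply Rmult_le_pos; [apply c0|]. left. now apply Rinv_0_lt_compat. }
{ now exists (- (c 1%nat / INR 1)), 0%nat. }
exists (- l).
assert (low : forall n, - l <= c (S n) / INR (S n)).
{ intros n. assert (- (c (S n) / INR (S n)) <= l); [|lra]. apply ub. now exists n. }
intros eps Heps.
destruct (classic (exists m, c (S m) / INR (S m) < - l + eps / 2)) as [[m Hm]|H].
2:{ exfalso. assert (l <= l - eps / 2); [|lra]. apply lub. intros x [m ->].
    apply Rnot_lt_le. intros Hlt. apply H. exists m. lra. }
set (M := S m) in *.
assert (mult : forall q, c (S q * M)%nat <= INR (S q) * c M).
{ induction q as [|q IH]; [rewrite Nat.mul_1_l; change (INR 1) with 1; lra|].
  replace (S (S q) * M)%nat with (M + S q * M)%nat by ring.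
  rewrite (S_INR (S q)).
  assert (Hs := sub M (S q * M)%nat ltac:(unfold M; lia) ltac:(unfold M; lia)). lra. }
assert (step : forall x r, (1 <= x)%nat -> c (x + r)%nat <= c x + INR r * c 1%nat).
{ intros x r Hx. induction r as [|r IH]; [rewrite Nat.add_0_r; cbn; lra|].
  replace (x + S r)%nat with (x + r + 1)%nat by lia. rewrite S_INR.
  assert (Hs := sub (x + r)%nat 1%nat ltac:(lia) ltac:(lia)). lra. }
(* Beyond this threshold the remainder term, at most [INR M * c 1], is less than [eps / 2] times the
   index. *)
destruct (INR_unbounded (2 * (INR M * c 1%nat + 1) / eps)) as [n0 Hn0].
exists (n0 + M)%nat. intros n Hn. unfold Rdist.
rewrite Rabs_pos_eq by (specialize (low n); lra).
set (k := S n) in *.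
assert (Hk : (k = M * (k / M) + k mod M)%nat) by (apply Nat.div_mod; unfold M; lia).
assert (Hr : (k mod M < M)%nat) by (apply Nat.mod_upper_bound; unfold M; lia).
assert (HkM : (n0 + M < k)%nat) by (unfold k; lia).
revert Hk Hr. generalize (k mod M)%nat as r. intros r Hk Hr.
destruct (k / M)%nat as [|q] eqn:Hq; [lia|].
assert (H1 : c k <= INR (S q) * c M + INR r * c 1%nat).
{ rewrite Hk at 1. replace (M * S q)%nat with (S q * M)%nat by lia.
  eapply Rle_trans; [apply step; unfold M; lia|]. specialize (mult q). lra. }
assert (kpos : 0 < INR k) by apply pos.
assert (Mpos : 0 < INR M) by apply pos.
assert (H2 : INR (S q) * INR M <= INR k).
{ rewrite <- mult_INR. apply le_INR. lia. }
assert (H3 : INR r <= INR M) by (apply le_INR; lia).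
assert (H4 : INR (S q) * c M <= INR k * (c M / INR M)).
{ replace (INR (S q) * c M) with (INR (S q) * INR M * (c M / INR M)) by (field; lra).
  apply Rmult_le_compat_r; [|assumption].
  apply Rmult_le_pos; [apply c0|]. left. now apply Rinv_0_lt_compat. }
assert (H5 : INR r * c 1%nat <= INR M * c 1%nat).
{ apply Rmult_le_compat_r; [apply c0|assumption]. }
assert (H6 : INR M * c 1%nat < INR k * (eps / 2)).
{ assert (Hnk : INR n0 <= INR k) by (apply le_INR; lia).
  assert (H : 2 * (INR M * c 1%nat + 1) / eps < INR k) by lra.
  apply (Rmult_lt_compat_r (eps / 2)) in H; [|lra].
  replace (2 * (INR M * c 1%nat + 1) / eps * (eps / 2)) with (INR M * c 1%nat + 1) in H by (field; lra).
  lra. }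
assert (H7 : c k / INR k < c M / INR M + eps / 2); [|lra].
apply (Rmult_lt_reg_r (INR k)); [assumption|].
replace (c k / INR k * INR k) with (c k) by (field; lra). lra.
Qed.

(** The least positive exponent that kills [x] is its order. *)
Lemma order_lower_bound (G : Group) (x : G) (N : nat) :
  (forall k, has_order x k -> (N <= k)%nat) ->
  forall j, (0 < j < N)%nat -> gpow x j <> gone.
Proof.
intros H j Hj Hx.
destruct (least_nat (fun k => (0 < k)%nat /\ gpow x k = gone) j) as [k [[k0 Hk] Hmin]];
  [now split|].
assert (Hkj := Hmin j (conj (proj1 Hj) Hx)).
assert (N <= k)%nat; [|lia]. apply H. split; [assumption|]. split; [assumption|].
intros i Hi Hxi. assert (k <= i)%nat by (apply Hmin; split; [lia|assumption]). lia.
Qed.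

Lemma has_order_ge2 (G : Group) (x : G) (N : nat) :
  x <> gone -> has_order x N -> (2 <= N)%nat.
Proof.
intros Hx [H0 [H1 _]]. destruct N as [|[|N]]; [lia| |lia].
cbn in H1. rewrite gmul_1r in H1. contradiction.
Qed.

Lemma Un_cv_ge (u : nat -> R) (l m : R) : Un_cv u l -> (forall n, m <= u n) -> m <= l.
Proof.
intros Hu Hm. apply Rnot_lt_le. intros Hlt.
destruct (Hu (m - l)) as [n Hn]; [lra|]. specialize (Hn n (Nat.le_refl n)).
unfold Rdist in Hn. apply Rabs_def2 in Hn. specialize (Hm n). lra.
Qed.

Theorem theorem3p1 (A B G : Group) (iA : A -> G) (iB : B -> G)
  (hfree : IsFreeProduct A B G iA iB)
  (L : nat) (hL : (1 <= L)%nat) (a : nat -> A) (b : nat -> B)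
  (ha : forall i, (i < L)%nat -> a i <> gone)
  (hb : forall i, (i < L)%nat -> b i <> gone)
  (g : G)
  (hg : g = gprod (map (fun i => gmul (iA (a i)) (iB (b i))) (seq 0 L)))
  (hcomm : in_commutator_subgroup G g)
  (N : option nat)
  (hN : min_order2 a b L N) :
  exists scl : R, Un_cv (cl_ratio G g) scl /\ 1 / 2 - inv_ext N <= scl.
Proof.
destruct (commutator_subgroup_comms G g hcomm) as [s Hs].
assert (pow : forall n, exists t, comms t = gpow g n).
{ induction n as [|n [t Ht]]; [now exists nil|].
  exists (s ++ t). rewrite comms_app, Hs, Ht. reflexivity. }
destruct (fekete (fun n => INR (cl G (gpow g n)))) as [l Hl].
{ intros n. apply pos_INR. }
{ intros m n _ _. rewrite <- plus_INR. apply le_INR.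
  destruct (pow m) as [t Ht]. destruct (pow n) as [u Hu].
  destruct (cl_comms G _ t Ht) as [[t' [<- Ht']] _].
  destruct (cl_comms G _ u Hu) as [[u' [<- Hu']] _].
  rewrite <- length_app. apply cl_comms. now rewrite comms_app, gpow_add, Ht', Hu'. }
exists l. split; [exact Hl|]. apply (Un_cv_ge _ _ _ Hl). intros n.
set (k := cl G (gpow g (S n))).
(* [M] is kept arbitrary: it will be the minimal order if that is finite, and a large number
   otherwise. *)
assert (bound : forall M, (2 <= M)%nat ->
  (forall i j, (i < L)%nat -> (0 < j < M)%nat -> gpow (a i) j <> gone) ->
  (forall i j, (i < L)%nat -> (0 < j < M)%nat -> gpow (b i) j <> gone) ->
  (M * S (S n) <= M * (2 * k) + 2 * S n)%nat).
{ intros M HM Ha Hb. destruct (pow (S n)) as [t Ht].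
  destruct (cl_comms G _ t Ht) as [[t' [Hk Ht']] _]. fold k in Hk. rewrite <- Hk.
  apply (@Fillings.commutator_product_bound_nat A B G iA iB hfree L M (S n) a b t');
    try assumption; [lia|]. unfold comms in Ht'. rewrite Ht', hg. reflexivity. }
assert (npos : 0 < INR (S n)) by (apply lt_0_INR; lia).
apply (Rmult_le_reg_r (INR (S n))); [assumption|].
replace (INR k / INR (S n) * INR (S n)) with (INR k) by (field; lra).
destruct N as [N|]; cbn [inv_ext min_order2] in *.
- destruct hN as [Hex [Ha Hb]].
  assert (N2 : (2 <= N)%nat).
  { destruct Hex as [[i [Hi Ho]]|[i [Hi Ho]]];
      [apply (has_order_ge2 A (a i))|apply (has_order_ge2 B (b i))]; auto. }
  assert (Hb' : (N * S (S n) <= N * (2 * k) + 2 * S n)%nat).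
  { apply bound; [assumption| |]; intros i j Hi; apply order_lower_bound; eauto. }
  (* Divided by [2 * N * S n], the inequality is the claimed bound on the ratio, with
     [1 / (2 * S n)] to spare. *)
  apply le_INR in Hb'. rewrite plus_INR, !mult_INR, (S_INR (S n)) in Hb'.
  assert (Npos : 0 < INR N) by (apply lt_0_INR; lia).
  apply (Rmult_le_reg_l (INR N)); [assumption|].
  replace (INR N * ((1 / 2 - / INR N) * INR (S n)))
    with (INR N * INR (S n) / 2 - INR (S n)) by (field; lra).
  change (INR 2) with 2 in Hb'. lra.
- destruct hN as [Ha Hb].
  (* With infinite orders any [M] is allowed; this one exceeds the error term [2 * S n], which then
     disappears by integrality. *)
  assert (Hb' : ((2 * S n + 1) * S (S n) <= (2 * S n + 1) * (2 * k) + 2 * S n)%nat).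
  { apply bound; [lia| |]; intros i j Hi Hj; [apply Ha|apply Hb]; lia. }
  assert (H : (S n <= 2 * k)%nat) by nia.
  apply le_INR in H. rewrite mult_INR in H. change (INR 2) with 2 in H. lra.
Qed.
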